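(* Let $X,Y$ be finite-dimensional real Euclidean spaces, $g:X\to(-\infty,+\infty]$ and $f:Y\to(-\infty,+\infty]$ proper closed convex functions, $f^*$ the convex conjugate of $f$, $K:X\to Y$ a linear operator, and assume $\mathcal{L}(x,y)=g(x)+\langle Kx,y\rangle-f^*(y)$ has at least one saddle point. Let $\{a_k\}_{k\ge1},\{b_k\}_{k\ge1}\subset(0,1)$ be monotonically non-increasing sequences, $\tau_0>0$, $\beta>0$, $\mu\in(0,1)$, $\theta>0$ an upper bound for the quantities $\theta_k$ below (e.g. $\theta=\frac{1+\sqrt5}{2}$), and $\delta\in(0,1)$ with $\delta+\theta^2a_k+a_k<1$ and $\delta+b_k<1$ for all $k$. Given $(x_0,y_1)\in X\times Y$, set $x_0^{ag}=x_0$, $y_1^{ag}=y_1$, $\theta_0=1$, and for $k=1,2,\dots$: (1) $x_k^{ag}=(1-a_k)x_{k-1}^{ag}+a_kx_{k-1}$, $y_{k+1}^{ag}=(1-b_{k+1})y_k^{ag}+b_{k+1}y_k$; (2) $x_k^{md}=(1-a_k)x_{k-1}+a_kx_k^{ag}$, $y_{k+1}^{md}=(1-b_{k+1})y_k+b_{k+1}y_{k+1}^{ag}$; (3) $x_k=\mathrm{Prox}_{\tau_{k-1}g}(x_k^{md}-\tau_{k-1}K^Ty_k)$; (4) set $\tau_k=\tau_{k-1}\sqrt{1+\theta_{k-1}}$ and perform the linesearch: compute $\theta_k=\tau_k/\tau_{k-1}$, $\bar x_k=x_k+\theta_k(x_k-x_{k-1})$, $y_{k+1}=\mathrm{Prox}_{\beta\tau_kf^*}(y_{k+1}^{md}+\beta\tau_kK\bar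 x_k)$; if $\sqrt\beta\,\tau_k\|K^Ty_{k+1}-K^Ty_k\|\le\delta\|y_{k+1}-y_k\|$ accept these values, otherwise replace $\tau_k$ by $\mu\tau_k$ and repeat the linesearch computations. Then the sequence $\{(x_k,y_k)\}$ converges to a saddle point of $\mathcal{L}$.
   Context: For a proper closed convex $h$ and $\lambda>0$, $\mathrm{Prox}_{\lambda h}(x)=\arg\min_{z}\{h(z)+\frac{1}{2\lambda}\|z-x\|^2\}$. $K^T$ is the adjoint of $K$. A saddle point $(\hat x,\hat y)$ satisfies $\mathcal{L}(\hat x,y)\le\mathcal{L}(\hat x,\hat y)\le\mathcal{L}(x,\hat y)$ for all $(x,y)$. This iteration is called NPDAL in the paper. *)

(* Defs.v *)
From HB Require Import structures.
From mathcomp Require Import all_boot all_order all_algebra.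
From mathcomp Require Import all_classical all_reals all_analysis.
Set Implicit Arguments. Unset Strict Implicit. Unset Printing Implicit Defensive.
Import Order.TTheory GRing.Theory Num.Theory.
Import numFieldNormedType.Exports.
Local Open Scope ring_scope.

(* The Euclidean spaces X, Y are
   R^n, R^m represented as row vectors 'rV[R]_n, 'rV[R]_m with the standard
   inner product; a linear operator K : X -> Y is a matrix K : 'M_(n,m)
   acting by x |-> x *m K, and its adjoint K^T acts by y |-> y *m K^T. *)

Section Defs.
Variable R : realType.

Definition dotv (n : nat) (u v : 'rV[R]_n) : R := (u *m v^T) 0 0.

Definition enorm (n : nat) (u : 'rV[R]_n) : R := Num.sqrt (dotv u u).

Local Open Scope ereal_scope.

Definition proper_fun (n : nat) (h : 'rV[R]_n -> \bar R) : Prop :=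
  (forall x, h x != -oo) /\ (exists x, h x != +oo).

(* convex (for functions with values in (-oo, +oo]) *)
Definition convex_fun (n : nat) (h : 'rV[R]_n -> \bar R) : Prop :=
  forall (x z : 'rV[R]_n) (t : R), (0 < t < 1)%R ->
    h (t *: x + (1 - t) *: z)%R <= t%:E * h x + (1 - t)%:E * h z.

Definition closed_fun (n : nat) (h : 'rV[R]_n -> \bar R) : Prop :=
  lower_semicontinuous h.

Definition proper_closed_convex (n : nat) (h : 'rV[R]_n -> \bar R) : Prop :=
  [/\ proper_fun h, closed_fun h & convex_fun h].

Definition conjugate (n : nat) (h : 'rV[R]_n -> \bar R) (y : 'rV[R]_n) : \bar R :=
  ereal_sup (range (fun x => (dotv x y)%:E - h x)).

Definition is_prox (n : nat) (h : 'rV[R]_n -> \bar R) (lam : R)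
    (v p : 'rV[R]_n) : Prop :=
  forall z, h p + ((enorm (p - v)%R) ^+ 2 / (2 * lam))%:E
            <= h z + ((enorm (z - v)%R) ^+ 2 / (2 * lam))%:E.

Definition lagrangian (n m : nat) (g : 'rV[R]_n -> \bar R)
   (f : 'rV[R]_m -> \bar R) (K : 'M[R]_(n, m)) (x : 'rV[R]_n) (y : 'rV[R]_m)
   : \bar R :=
  g x + (dotv (x *m K) y)%:E - conjugate f y.

(* saddle point of L (with hx in dom g, hy in dom f^*, so L(hx,hy) is finite
   and all the inequalities are free of +oo - +oo ambiguities) *)
Definition saddle_point (n m : nat) (g : 'rV[R]_n -> \bar R)
   (f : 'rV[R]_m -> \bar R) (K : 'M[R]_(n, m)) (hx : 'rV[R]_n) (hy : 'rV[R]_m)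
   : Prop :=
  [/\ g hx \is a fin_num, conjugate f hy \is a fin_num &
      forall x y, lagrangian g f K hx y <= lagrangian g f K hx hy /\
                  lagrangian g f K hx hy <= lagrangian g f K x hy].

End Defs.

(* Main.v *)
Require Import Defs.
From HB Require Import structures.
From mathcomp Require Import all_boot all_order all_algebra.
From mathcomp Require Import all_classical all_reals all_analysis.
From mathcomp Require Import ring lra.
Import Order.TTheory GRing.Theory Num.Theory.
Import numFieldNormedType.Exports.
Set Implicit Arguments.
Unset Strict Implicit.
Unset Printing Implicit Defensive.
Local Open Scope classical_set_scope.
Local Open Scope ring_scope.

(* For a saddle point (hx, hy) the energy made of the squared distances of x_k, y_k and,
   with weights 1 - a_k and 1 - b_k, of the averaged points xag_k, yag_k to it, plus
   2 tau_k (1 + theta_k) (L(x_k, hy) - L(hx, hy)), decreases up to a rescaling, which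
   bounds the iterates and makes their increments vanish; all cluster points are then
   saddle points.
   Two difficulties remain, since neither tau_k nor the sums of a_k and b_k are bounded.
   First, the Lagrangian gap term has to vanish along a subsequence. If the linesearch
   backtracks infinitely often, the energy loses the fraction 1 - mu^2 of this term each
   time. Otherwise tau_k grows geometrically, the linesearch test makes K^T y_k converge at
   rate 1 / tau_k, and the proximal inequality for x_k bounds the gap term.
   Second, xag_k and yag_k may lag behind, so the energy at a cluster point need not tend
   to 0. Each of the two averages moves towards its iterate, and the energy splits between
   iterates and averages; since the averages carry all of it infinitely often, they
   eventually carry all of it at every time, so that the iterates converge. *)

(** * Euclidean vectors *)

Section InnerProduct.
Context {R : realType}.
Implicit Types (n m : nat).

Lemma dotvE n (u v : 'rV[R]_n) : dotv u v = \sum_i u 0 i * v 0 i.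
Proof. by rewrite /dotv mxE; apply: eq_bigr => i _; rewrite mxE. Qed.

Lemma dotvC n (u v : 'rV[R]_n) : dotv u v = dotv v u.
Proof. by rewrite !dotvE; apply: eq_bigr => i _; rewrite mulrC. Qed.

Lemma dotvDl n (u v w : 'rV[R]_n) : dotv (u + v) w = dotv u w + dotv v w.
Proof. by rewrite /dotv mulmxDl mxE. Qed.

Lemma dotvDr n (u v w : 'rV[R]_n) : dotv w (u + v) = dotv w u + dotv w v.
Proof. by rewrite !(dotvC w) dotvDl. Qed.

Lemma dotvZl n (k : R) (u w : 'rV[R]_n) : dotv (k *: u) w = k * dotv u w.
Proof. by rewrite /dotv -scalemxAl mxE. Qed.

Lemma dotvZr n (k : R) (u w : 'rV[R]_n) : dotv w (k *: u) = k * dotv w u.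
Proof. by rewrite !(dotvC w) dotvZl. Qed.

Lemma dotvNl n (u w : 'rV[R]_n) : dotv (- u) w = - dotv u w.
Proof. by rewrite -scaleN1r dotvZl mulN1r. Qed.

Lemma dotvNr n (u w : 'rV[R]_n) : dotv w (- u) = - dotv w u.
Proof. by rewrite !(dotvC w) dotvNl. Qed.

Lemma dotv0l n (u : 'rV[R]_n) : dotv 0 u = 0.
Proof. by rewrite -(scale0r 0) dotvZl mul0r. Qed.

Definition dotv_lin := (dotvDl, dotvDr, dotvZl, dotvZr, dotvNl, dotvNr).

Lemma dotv_sqrDZ n (t : R) (u w : 'rV[R]_n) :
  dotv (u + t *: w) (u + t *: w) =
  dotv u u + 2 * t * dotv u w + t ^+ 2 * dotv w w.
Proof. by rewrite !dotv_lin (dotvC w u); ring. Qed.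

Lemma dotv_ge0 n (u : 'rV[R]_n) : 0 <= dotv u u.
Proof. by rewrite dotvE; apply: sumr_ge0 => i _; rewrite -expr2 sqr_ge0. Qed.

Lemma enormK n (u : 'rV[R]_n) : enorm u ^+ 2 = dotv u u.
Proof. by rewrite /enorm sqr_sqrtr ?dotv_ge0. Qed.

Lemma enorm_ge0 n (u : 'rV[R]_n) : 0 <= enorm u.
Proof. exact: sqrtr_ge0. Qed.

Lemma dotv_young n (k : R) (u v : 'rV[R]_n) :
  2 * k * dotv u v <= k ^+ 2 * dotv u u + dotv v v.
Proof.
have := dotv_ge0 (k *: u - v).
by rewrite !dotv_lin (dotvC v u); lra.
Qed.

Lemma dotvD_le n (u v : 'rV[R]_n) :
  dotv (u + v) (u + v) <= 2 * dotv u u + 2 * dotv v v.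
Proof. by have := dotv_young 1 u v; rewrite !dotv_lin (dotvC v u); lra. Qed.

Lemma dotv_convex n (t : R) (u v : 'rV[R]_n) : 0 <= t <= 1 ->
  dotv ((1 - t) *: u + t *: v) ((1 - t) *: u + t *: v) <=
  (1 - t) * dotv u u + t * dotv v v.
Proof.
move=> /andP[t0 t1]; rewrite -subr_ge0.
have -> : (1 - t) * dotv u u + t * dotv v v
    - dotv ((1 - t) *: u + t *: v) ((1 - t) *: u + t *: v) =
    t * (1 - t) * dotv (u - v) (u - v).
  by rewrite !dotv_lin (dotvC v u); ring.
by rewrite mulr_ge0 ?dotv_ge0 // mulr_ge0 ?subr_ge0.
Qed.

Lemma dotv_adj n m (K : 'M[R]_(n, m)) (u : 'rV[R]_n) (v : 'rV[R]_m) :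
  dotv (u *m K) v = dotv u (v *m K^T).
Proof. by rewrite /dotv trmx_mul trmxK mulmxA. Qed.

Lemma dotv_CS n (u v : 'rV[R]_n) : dotv u v ^+ 2 <= dotv u u * dotv v v.
Proof.
have u0 := dotv_ge0 u; have v0 := dotv_ge0 v.
have [uE|un0] := eqVneq (dotv u u) 0.
  rewrite uE mul0r.
  have [->|w0] := eqVneq (dotv u v) 0; first by rewrite expr0n.
  (* With this factor Young's inequality would read [dotv v v + 1 <= dotv v v]. *)
  have := dotv_young ((dotv v v + 1) / (2 * dotv u v)) u v.
  have -> : 2 * ((dotv v v + 1) / (2 * dotv u v)) * dotv u v = dotv v v + 1.
    by field.
  by rewrite uE; lra.
have := dotv_young (dotv u v / dotv u u) u v.
have -> : (dotv u v / dotv u u) ^+ 2 * dotv u u = dotv u v ^+ 2 / dotv u u by field.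
have -> : 2 * (dotv u v / dotv u u) * dotv u v = 2 * (dotv u v ^+ 2 / dotv u u) by field.
have u1 : 0 < dotv u u by rewrite lt_neqAle eq_sym un0.
move=> H; have : dotv u v ^+ 2 / dotv u u <= dotv v v by lra.
by rewrite ler_pdivrMr // mulrC.
Qed.

(** The constant is 1 plus the squared Frobenius norm of [K]; the 1 keeps it positive for
    [K = 0]. *)
Lemma mulmx_bound n m (K : 'M[R]_(n, m)) :
  exists2 C : R, 0 < C & forall u : 'rV[R]_n, dotv (u *m K) (u *m K) <= C * dotv u u.
Proof.
exists (1 + \sum_j dotv (col j K)^T (col j K)^T).
  by rewrite ltr_pwDl // sumr_ge0 // => j _; rewrite dotv_ge0.
move=> u; rewrite mulrDl mul1r dotvE mulr_suml.
rewrite -[leLHS]add0r lerD ?dotv_ge0 //; apply: ler_sum => j _.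
have -> : (u *m K) 0 j = dotv (col j K)^T u.
  by rewrite dotvC dotvE mxE; apply: eq_bigr => i _; rewrite !mxE.
by rewrite -expr2; apply: dotv_CS.
Qed.

Lemma dotv_row_mx n m (u u' : 'rV[R]_n) (v v' : 'rV[R]_m) :
  dotv (row_mx u v) (row_mx u' v') = dotv u u' + dotv v v'.
Proof. by rewrite /dotv tr_row_mx mul_row_col mxE. Qed.

Lemma coord_le_dotv n (u : 'rV[R]_n) i : (u 0 i) ^+ 2 <= dotv u u.
Proof.
rewrite dotvE (bigD1 i) //= expr2 ler_wpDr // sumr_ge0 // => j _.
by rewrite -expr2 sqr_ge0.
Qed.

(** Row vectors carry the topology of entrywise balls; passing to Euclidean balls lets all later
    estimates use squared norms only. *)
Lemma nbhs_dotvP n (p : 'rV[R]_n) (A : set 'rV[R]_n) :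
  nbhs p A <->
  exists2 e : R, 0 < e & forall z, dotv (z - p) (z - p) < e -> A z.
Proof.
split.
  move/nbhs_ballP => [e /= e0 eA]; exists (e ^+ 2); first by rewrite exprn_gt0.
  move=> z ze; apply: eA; split=> // i j; rewrite (ord1 i) /ball /=.
  rewrite -(ltr_pXn2r (n := 2)) ?nnegrE ?normr_ge0 ?(ltW e0) //.
  apply: le_lt_trans ze; rewrite distrC real_normK ?num_real //.
  by have := coord_le_dotv (z - p) j; rewrite !mxE.
move=> [e e0 eA]; apply/nbhs_ballP.
have k0 : 0 < e / n.+1%:R by rewrite divr_gt0.
(* The cap 1 makes the square of an entry at most its modulus, and [n.+1] makes the final bound
   strict. *)
exists (Num.min 1 (e / n.+1%:R)) => /=; first by rewrite lt_min ltr01.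
move=> z pz; apply: eA; rewrite dotvE.
apply: (@le_lt_trans _ _ (\sum_(i < n) e / n.+1%:R)).
  apply: ler_sum => i _; rewrite !mxE -expr2.
  have := pz.2 0 i; rewrite /ball /= distrC lt_min => /andP[h1 h2].
  rewrite -real_normK ?num_real //; apply: ltW; apply: le_lt_trans h2.
  by rewrite expr2 ler_piMl // ltW.
rewrite sumr_const card_ord -[ltLHS]mulr_natr -mulrA gtr_pMr // mulrC.
by rewrite ltr_pdivrMr // mul1r ltr_nat.
Qed.

(** * Sequences tending to 0 in squared norm *)

Definition vanish n (u : nat -> 'rV[R]_n) := (fun k => dotv (u k) (u k)) @ \oo --> 0.

Lemma cvg0D (u v : nat -> R) :
  u @ \oo --> 0 -> v @ \oo --> 0 -> (fun k => u k + v k) @ \oo --> 0.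
Proof. by move=> u0 v0; rewrite -[X in _ --> X](addr0 0); apply: cvgD. Qed.

Lemma cvg0Ml (c : R) (u : nat -> R) :
  u @ \oo --> 0 -> (fun k => c * u k) @ \oo --> 0.
Proof. by move=> u0; rewrite -[X in _ --> X](mulr0 c); apply: cvgMl_tmp. Qed.


Lemma vanish_le n (u : nat -> 'rV[R]_n) (r : nat -> R) :
  r @ \oo --> 0 -> (\forall k \near \oo, dotv (u k) (u k) <= r k) -> vanish u.
Proof.
move=> r0 ur; apply: (squeeze_cvgr (f := fun=> 0) (h := r)) => //.
  by apply: filterS ur => k ->; rewrite dotv_ge0.
exact: cvg_cst.
Qed.

Lemma vanish_lt n (u : nat -> 'rV[R]_n) (e : R) :
  vanish u -> 0 < e -> \forall k \near \oo, dotv (u k) (u k) < e.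
Proof.
rewrite /vanish => u0 e0; apply: filterS (cvgr0_norm_lt _ u0 _ e0) => k.
by rewrite ger0_norm ?dotv_ge0.
Qed.

Lemma vanish_cvg n (z : nat -> 'rV[R]_n) (p : 'rV[R]_n) :
  vanish (fun k => z k - p) -> z @ \oo --> p.
Proof.
move=> z0 A /nbhs_dotvP[e e0 eA].
by apply: filterS (vanish_lt z0 e0) => k; apply: eA.
Qed.

Lemma vanishD n (u v : nat -> 'rV[R]_n) :
  vanish u -> vanish v -> vanish (fun k => u k + v k).
Proof.
move=> u0 v0; apply: (@vanish_le _ _ (fun k => 2 * dotv (u k) (u k) + 2 * dotv (v k) (v k))).
  by apply: cvg0D; apply: cvg0Ml.
by apply: nearW => k; apply: dotvD_le.
Qed.

Lemma vanishN n (u : nat -> 'rV[R]_n) : vanish u -> vanish (fun k => - u k).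
Proof. by rewrite /vanish; under [X in _ -> X @ _ --> _]eq_fun do rewrite dotvNl dotvNr opprK. Qed.

Lemma vanishZ n (c : nat -> R) (u : nat -> 'rV[R]_n) B :
  (\forall k \near \oo, `|c k| <= B) -> vanish u -> vanish (fun k => c k *: u k).
Proof.
move=> cB u0; apply: (@vanish_le _ _ (fun k => B ^+ 2 * dotv (u k) (u k))).
  exact: cvg0Ml.
apply: filterS cB => k cB; rewrite dotvZl dotvZr mulrA ler_wpM2r ?dotv_ge0 //.
by rewrite -expr2 -real_normK ?num_real // !expr2 ler_pM.
Qed.

Lemma vanish_mulmx n m (K : 'M[R]_(n, m)) (u : nat -> 'rV[R]_n) :
  vanish u -> vanish (fun k => u k *m K).
Proof.
have [C C0 hC] := mulmx_bound K.
move=> u0; apply: (@vanish_le _ _ (fun k => C * dotv (u k) (u k))).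
  exact: cvg0Ml.
by apply: nearW => k; apply: hC.
Qed.

(** [s] need not be increasing: [k <= s k] suffices for limits and is what [choice] delivers. *)
Lemma cvg_subseq (u : nat -> R) (l : R) (s : nat -> nat) :
  (forall k, (k <= s k)%N) -> u @ \oo --> l -> (fun k => u (s k)) @ \oo --> l.
Proof.
move=> sk ul A /ul[N _ hN]; exists N => // k Nk; apply: hN => /=.
exact: leq_trans Nk (sk k).
Qed.

Lemma cvg_dotv0 n (u v : nat -> 'rV[R]_n) B :
  vanish u -> (\forall k \near \oo, dotv (v k) (v k) <= B) ->
  (fun k => dotv (u k) (v k)) @ \oo --> 0.
Proof.
move=> u0 vB; apply/cvgr0Pnorm_lt => e e0.
have B1 : 0 < `|B| + 1 by rewrite ltr_wpDl.
apply: filterS2 vB (vanish_lt u0 (divr_gt0 (exprn_gt0 2 e0) B1)) => k vB.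
rewrite ltr_pdivlMr // => h.
rewrite -(ltr_pXn2r (n := 2)) ?nnegrE ?(ltW e0) // real_normK ?num_real //.
apply: le_lt_trans (dotv_CS _ _) (le_lt_trans _ h).
apply: ler_wpM2l; first exact: dotv_ge0.
by have := ler_norm B; lra.
Qed.

Lemma cvg_dotv n (u v : nat -> 'rV[R]_n) p q :
  vanish (fun k => u k - p) -> vanish (fun k => v k - q) ->
  (fun k => dotv (u k) (v k)) @ \oo --> dotv p q.
Proof.
move=> up vq.
have h1 : (fun k => dotv (u k - p) q) @ \oo --> 0.
  by apply: (@cvg_dotv0 _ _ _ (dotv q q)) => //; apply: nearW.
have h2 : (fun k => dotv (v k - q) p) @ \oo --> 0.
  by apply: (@cvg_dotv0 _ _ _ (dotv p p)) => //; apply: nearW.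
have h3 : (fun k => dotv (u k - p) (v k - q)) @ \oo --> 0.
  apply: (@cvg_dotv0 _ _ _ 1) => //.
  by apply: filterS (vanish_lt vq ltr01) => k /ltW.
have -> : (fun k => dotv (u k) (v k)) =
    (fun k => dotv (u k - p) (v k - q) + dotv (u k - p) q + dotv (v k - q) p + dotv p q).
  by apply: funext => k; rewrite !dotv_lin (dotvC (v k) p) (dotvC q p); ring.
rewrite -[X in _ --> X]add0r -[X in _ --> X + _](addr0 0) -[X in _ --> X + _ + _](addr0 0).
by apply: cvgD (cvgD (cvgD h3 h1) h2) _; exact: cvg_cst.
Qed.

End InnerProduct.

(** * Proximal points and saddle points *)

Section Compactness.
Context {R : realType}.

(** Bolzano-Weierstrass along the indices in [Q]: the image of the filter [within Q \oo] under [z]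
    lives on a compact box, so it has a cluster point, and indices with squared distance below
    [harmonic k] can be chosen. *)
Lemma bounded_subsequence n (z : nat -> 'rV[R]_n) (Q : nat -> Prop) (B : R) :
  (forall k, Q k -> dotv (z k) (z k) <= B) ->
  (forall N, exists2 k, (N <= k)%N & Q k) ->
  exists p (s : nat -> nat),
    (forall k, (k <= s k)%N /\ Q (s k)) /\
    vanish (fun k => z (s k) - p).
Proof.
move=> zB Qinf.
pose A : 'I_n -> set R := fun=> [set` `[- (1 + B), 1 + B]].
have Ac : forall i, compact (A i) by move=> i; exact: segment_compact.
pose F := z @ within Q \oo.
have FF : ProperFilter F.
  apply: Build_ProperFilter => -[N _ hN].
  by have [k Nk Qk] := Qinf N; exact: hN Nk Qk.
have FA : F [set v | forall i, A i (v 0 i)].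
  exists 0%N => // k _ Qk i; rewrite /A /= in_itv /= -ler_norml.
  have := zB k Qk; have := coord_le_dotv (z k) i.
  have B1 : 0 <= 1 + B.
    by have := zB k Qk; have := dotv_ge0 (z k); lra.
  move=> h1 h2; rewrite -(ler_pXn2r (n := 2)) ?nnegrE //.
  by rewrite real_normK ?num_real //; nra.
have [p [_ pF]] := rV_compact Ac FF FA.
have : forall k, exists j, ((k <= j)%N /\ Q j) /\
    dotv (z j - p) (z j - p) < harmonic k.
  move=> k.
  have F1 : F [set v | exists2 j, (k <= j)%N /\ Q j & v = z j].
    by exists k => // j kj Qj; exists j.
  have F2 : nbhs p [set v | dotv (v - p) (v - p) < harmonic k].
    by apply/nbhs_dotvP; exists (harmonic k) => //; rewrite invr_gt0.
  by have [_ [[j kj ->] jp]] := pF _ _ F1 F2; exists j.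
move=> /choice[s sP]; exists p, s; split=> [k|]; first exact: (sP k).1.
apply: (squeeze_cvgr (f := fun=> 0) (h := harmonic)).
- by apply: nearW => k; rewrite dotv_ge0 ltW //; exact: (sP k).2.
- exact: cvg_cst.
- exact: cvg_harmonic.
Qed.

(** Otherwise a real [c] lies strictly between [l] and [h p]; semicontinuity gives [h > c] near [p],
    while [r k < c] eventually. *)
Lemma lsc_limit n (h : 'rV[R]_n -> \bar R) (z : nat -> 'rV[R]_n) p r (l : R) :
  lower_semicontinuous h ->
  vanish (fun k => z k - p) ->
  r @ \oo --> l -> (forall k, (h (z k) <= (r k)%:E)%E) -> (h p <= l%:E)%E.
Proof.
move=> lsc zp rl hr; rewrite leNgt; apply/negP => lh.
have [c lc ch] : exists2 c : R, l < c & (c%:E < h p)%E.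
  case: (h p) lh => [t| |//] lt.
    by rewrite lte_fin in lt; exists ((l + t) / 2); rewrite ?lte_fin; lra.
  by exists (l + 1); rewrite ?ltry // ltrDl.
have [V /nbhs_dotvP [e e0 eV] Vc] := lsc _ _ ch.
have [N1 _ h1] := vanish_lt zp e0.
have lc0 : 0 < c - l by rewrite subr_gt0.
have [N2 _ h2] := cvgr_distC_lt _ _ rl _ lc0.
pose k := (N1 + N2)%N.
have := h1 k (leq_addr _ _); rewrite /= => zk.
have := h2 k (leq_addl _ _); rewrite /= => rk.
have := lt_le_trans (Vc _ (eV _ zk)) (hr k); rewrite lte_fin.
by have := ler_norm (r k - l); lra.
Qed.

End Compactness.

Section ConvexAnalysis.
Context {R : realType}.
Implicit Types (n m : nat).

Lemma prox_dom n (h : 'rV[R]_n -> \bar R) (lam : R) v p z :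
  (forall x, h x != -oo%E) -> is_prox h lam v p -> h z \is a fin_num ->
  h p \is a fin_num.
Proof.
move=> hN /(_ z); have := hN p; case: (h p) => //.
by case: (h z) => // r _; rewrite addye // -EFinD leye_eq.
Qed.

(** Compare [p] with the points [t z + (1 - t) p] of the segment, divide by [t] and let [t] tend to
    0. *)
Lemma prox_ineq n (h : 'rV[R]_n -> \bar R) (lam : R) v p z :
  convex_fun h -> 0 < lam -> is_prox h lam v p ->
  h p \is a fin_num -> h z \is a fin_num ->
  lam * (fine (h p) - fine (h z)) <= dotv (p - v) (z - p).
Proof.
move=> cv lam0 pr /fineK; set a := fine _ => ha /fineK; set b := fine _ => hb.
have key t : 0 < t < 1 ->
    lam * (a - b) <= dotv (p - v) (z - p) + t / 2 * dotv (z - p) (z - p).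
  move=> /[dup] t01 /andP[t0 t1].
  have := cv z p t t01; rewrite -ha -hb -!EFinM -EFinD => ct.
  have := le_trans (pr _) (leeD2r _ ct); rewrite -ha -!EFinD lee_fin !enormK.
  have -> : t *: z + (1 - t) *: p - v = (p - v) + t *: (z - p).
    by rewrite scalerBl scale1r scalerBr -!addrA addrC -!addrA;
       congr (_ + _); rewrite addrC -!addrA; congr (_ + _); rewrite addrC.
  rewrite dotv_sqrDZ.
  set A := dotv (p - v) (p - v); set C := dotv _ _; set D := dotv _ _ => H.
  have H2 : A <= (t * b - t * a) * (2 * lam) + (A + 2 * t * C + t ^+ 2 * D).
    rewrite -[leLHS](@divfK _ (2 * lam)); last by rewrite gt_eqF // mulr_gt0.
    rewrite -[X in _ <= _ + X](@divfK _ (2 * lam)); last by rewrite gt_eqF // mulr_gt0.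
    by rewrite -mulrDl ler_pM2r ?mulr_gt0 //; lra.
  have : t * (lam * (a - b)) <= t * (C + t / 2 * D) by lra.
  by rewrite ler_pM2l.
set C := dotv _ _ in key *; set D := dotv _ _ in key.
have D0 : 0 <= D by exact: dotv_ge0.
rewrite leNgt; apply/negP => AC.
(* In place of a limit, a [t] so small that the error [t / 2 * D] stays below the supposed
   violation. *)
pose t := Num.min (1 / 2) ((lam * (a - b) - C) / (D + 1)).
have q0 : 0 < (lam * (a - b) - C) / (D + 1) by rewrite divr_gt0 ?subr_gt0 // ltr_wpDl.
have t01 : 0 < t < 1.
  by rewrite /t lt_min q0 andbT gt_min; apply/andP; split; [lra|apply/orP; left; lra].
have := key t t01.
have : t * (D + 1) <= lam * (a - b) - C.
  by rewrite -ler_pdivlMr ?ltr_wpDl // /t ge_min lexx orbT.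
by move: t01 => /andP[? ?]; nra.
Qed.

(** Direct method: the affine minorant makes the objective coercive, and lower semicontinuity passes
    to the limit of a minimizing sequence. This supplies the trial point of a rejected linesearch
    step. *)
Lemma prox_exists n (h : 'rV[R]_n -> \bar R) (lam : R) v z0 c d :
  lower_semicontinuous h -> 0 < lam -> h z0 \is a fin_num ->
  (forall z, ((dotv c z - d)%:E <= h z)%E) ->
  exists p, is_prox h lam v p.
Proof.
move=> lsc lam0 hz0 hmin.
pose N z := dotv (z - v) (z - v) / (2 * lam).
pose Phi z := (h z + (N z)%:E)%E.
have l2 : 0 < 2 * lam by rewrite mulr_gt0.
have hNy z : h z != -oo%E.
  by have := hmin z; case: (h z) => //; rewrite leeNy_eq.
(* Coercivity: of two copies of [dotv (z - v) (z - v)], one absorbs the linear term by Young's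
   inequality. *)
have lb : exists B : R, forall z, dotv (z - v) (z - v) <= 4 * lam * (N z + dotv c z) + B.
  exists (4 * lam ^+ 2 * dotv c c - 4 * lam * dotv c v) => z.
  have -> : 4 * lam * (N z + dotv c z) = 2 * dotv (z - v) (z - v) + 4 * lam * dotv c z.
    by rewrite /N; field; rewrite gt_eqF.
  have := dotv_young (- (2 * lam)) c (z - v).
  by rewrite (dotvDr _ _ c) dotvNr; nra.
have [B hB] := lb.
pose J := ereal_inf (range Phi).
have I_lb z : (J <= Phi z)%E by apply: ereal_inf_lbound; exists z.
have PhiB z : ((- (B / (4 * lam)) - d)%:E <= Phi z)%E.
  apply: (@le_trans _ _ ((dotv c z - d + N z)%:E)).
    rewrite lee_fin; have := hB z; have := dotv_ge0 (z - v).
    move=> h1 h2; have : 0 <= 4 * lam * (N z + dotv c z) + B by lra.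
    rewrite -(pmulr_rge0 (x := (4 * lam)^-1)) ?invr_gt0; last by lra.
    rewrite mulrDr mulrA mulVf ?mul1r; last by rewrite gt_eqF //; lra.
    by rewrite [_ * B]mulrC; lra.
  by rewrite EFinD leeD2r.
have Ifin : J \is a fin_num.
  rewrite fin_numElt; apply/andP; split.
    apply: (@lt_le_trans _ _ ((- (B / (4 * lam)) - d)%:E)); first by rewrite ltNyr.
    by apply: le_ereal_inf_tmp => _ [z _ <-].
  apply: le_lt_trans (I_lb z0) _; rewrite /Phi -(fineK hz0) -EFinD; exact: ltry.
have JK := fineK Ifin; set i := fine J in JK.
have : forall k, exists z, (Phi z <= (i + harmonic k)%:E)%E.
  move=> k; have k0 : (0 < (@harmonic R k)%:E)%E by rewrite lte_fin invr_gt0.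
  have [_ [z _ <-] hz] := lb_ereal_inf_adherent k0 Ifin.
  by exists z; rewrite EFinD JK ltW.
move=> /choice[z hz].
have hzr k : (h (z k) <= (i + harmonic k - N (z k))%:E)%E.
  by have := hz k; rewrite /Phi; case: (h (z k)) (hNy (z k)) => // r _;
    rewrite -EFinD !lee_fin; lra.
have zB k : True -> dotv (z k - v) (z k - v) <= 4 * lam * (i + 1 + d) + B.
  move=> _; apply: le_trans (hB _) _; rewrite lerD2r ler_pM2l; last by lra.
  have := le_trans (hmin (z k)) (hzr k); rewrite lee_fin.
  have : @harmonic R k <= 1 by rewrite invf_le1 ?ler1n.
  by lra.
have [p [s [sP sp]]] := bounded_subsequence (z := fun k => z k - v) (Q := fun=> True)
  zB (fun N => ex_intro2 _ _ N (leqnn N) Logic.I).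
exists (p + v).
have dp k : z (s k) - v - p = z (s k) - (p + v) by rewrite opprD addrA addrAC.
have hp : (h (p + v)%R <= (i - N (p + v))%:E)%E.
  apply: (@lsc_limit _ _ _ (z \o s) _ (fun k => i + harmonic (s k) - N (z (s k)))) => //.
  - by rewrite /vanish; under eq_fun do rewrite /= -dp.
  - have hs : (fun k => @harmonic R (s k)) @ \oo --> 0.
      exact: cvg_subseq (fun k => (sP k).1) cvg_harmonic.
    have Ns : (fun k => N (z (s k))) @ \oo --> N (p + v).
      have sp' : vanish (fun k => z (s k) - v - (p + v - v)) by rewrite addrK.
      exact: cvgMr_tmp (cvg_dotv sp' sp').
    rewrite -[X in _ --> X - _]addr0; apply: cvgB => //; apply: cvgD => //.
    exact: cvg_cst.
  - by move=> k; exact: hzr.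
move=> w; rewrite !enormK -/(N _) -/(N _).
apply: (@le_trans _ _ i%:E); last by rewrite JK; exact: I_lb.
by move: hp (hNy (p + v)); case: (h (p + v)) => // r; rewrite -EFinD !lee_fin; lra.
Qed.

Lemma conjugate_minorant n (f : 'rV[R]_n -> \bar R) : proper_fun f ->
  exists c d, forall y, ((dotv c y - d)%:E <= conjugate f y)%E.
Proof.
move=> [fN [x fx]]; exists x, (fine (f x)) => y.
apply: ereal_sup_ubound; exists x => //.
by rewrite EFinB fineK // fin_numE fN fx.
Qed.

Lemma conjugate_neqNy n (f : 'rV[R]_n -> \bar R) y :
  proper_fun f -> conjugate f y != -oo%E.
Proof.
move=> /conjugate_minorant[c [d /(_ y)]].
by case: (conjugate f y) => //; rewrite leeNy_eq.
Qed.

Lemma conjugate_lsc n (f : 'rV[R]_n -> \bar R) :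
  proper_fun f -> lower_semicontinuous (conjugate f).
Proof.
move=> [fN _] y t /ereal_sup_gt[_ [x _ <-]] tx.
have fx : f x \is a fin_num.
  by rewrite fin_numE fN /=; apply: contraTneq tx => ->.
exists [set z | (t%:E < (dotv x z)%:E - f x)%E]; last first.
  move=> z /= tz; apply: lt_le_trans tz _.
  by apply: ereal_sup_ubound; exists x.
move: tx; rewrite -(fineK fx) -EFinB lte_fin => tx.
pose d := dotv x y - fine (f x) - t.
have d0 : 0 < d by rewrite subr_gt0.
have x1 : 0 < dotv x x + 1 by rewrite ltr_wpDl ?dotv_ge0.
(* By Cauchy-Schwarz this radius keeps [dotv x (z - y)] below [d] in modulus; the 1 covers
   [x = 0]. *)
apply/nbhs_dotvP; exists (d ^+ 2 / (dotv x x + 1)); first by rewrite divr_gt0 ?exprn_gt0.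
move=> z; rewrite ltr_pdivlMr //= -EFinB lte_fin => zy.
have := dotv_CS x (z - y); rewrite dotvDr dotvNr.
have := dotv_ge0 (z - y).
set D := dotv (z - y) _ in zy *; set a := dotv x z.
move: zy; rewrite /d; set b := dotv x y; set r := fine _ => zy D0 cs.
rewrite ltNge; apply/negP => le.
have : (b - r - t) ^+ 2 <= (a - b) ^+ 2.
  rewrite -[(a - b) ^+ 2]sqrrN opprB; move: d0; rewrite /d -/b -/r => d0.
  by rewrite ler_pXn2r ?nnegrE //; lra.
by lra.
Qed.

Lemma conjugate_convex n (f : 'rV[R]_n -> \bar R) :
  proper_fun f -> convex_fun (conjugate f).
Proof.
move=> fp y z t /andP[t0 t1]; apply: ge_ereal_sup => _ [x _ <-].
have [fN _] := fp; have := fN x; case fx : (f x) => [r| |] // _; last first.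
  by rewrite addeNy leNye.
have h w : ((dotv x w - r)%:E <= conjugate f w)%E.
  by apply: ereal_sup_ubound; exists x => //; rewrite fx EFinB.
rewrite -EFinB dotvDr !dotvZr.
have -> : t * dotv x y + (1 - t) * dotv x z - r =
  t * (dotv x y - r) + (1 - t) * (dotv x z - r) by ring.
by rewrite EFinD !EFinM leeD // lee_pmul2l ?lte_fin ?subr_gt0.
Qed.

(** * Saddle points as pairs of variational inequalities *)

Lemma saddle_gap_primal n m (g : 'rV[R]_n -> \bar R) (f : 'rV[R]_m -> \bar R)
    (K : 'M[R]_(n, m)) hx hy x :
  saddle_point g f K hx hy -> g x \is a fin_num ->
  0 <= fine (g x) - fine (g hx) + dotv (hy *m K^T) (x - hx).
Proof.
move=> [/fineK ghx /fineK fhy /(_ x hy)[_ H]] /fineK gx; move: H.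
rewrite /lagrangian -ghx -fhy -gx -!EFinD lee_fin !(dotv_adj K) dotvDr dotvNr /=.
by rewrite !(dotvC (hy *m _)); lra.
Qed.

Lemma saddle_gap_dual n m (g : 'rV[R]_n -> \bar R) (f : 'rV[R]_m -> \bar R)
    (K : 'M[R]_(n, m)) hx hy y :
  saddle_point g f K hx hy -> conjugate f y \is a fin_num ->
  0 <= fine (conjugate f y) - fine (conjugate f hy) - dotv (hx *m K) (y - hy).
Proof.
move=> [/fineK ghx /fineK fhy /(_ hx y)[H _]] /fineK fy; move: H.
rewrite /lagrangian -ghx -fhy -fy -!EFinD lee_fin dotvDr dotvNr /=.
by lra.
Qed.

(** Where [g] or [conjugate f] is infinite the Lagrangian inequality is trivial, so comparison with
    points of the two domains suffices. *)
Lemma saddle_pointI n m (g : 'rV[R]_n -> \bar R) (f : 'rV[R]_m -> \bar R)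
    (K : 'M[R]_(n, m)) hx hy :
  proper_fun g -> proper_fun f ->
  g hx \is a fin_num -> conjugate f hy \is a fin_num ->
  (forall x, g x \is a fin_num ->
    fine (g hx) <= fine (g x) + dotv (hy *m K^T) (x - hx)) ->
  (forall y, conjugate f y \is a fin_num ->
    fine (conjugate f hy) <= fine (conjugate f y) - dotv (hx *m K) (y - hy)) ->
  saddle_point g f K hx hy.
Proof.
move=> [gN _] fp gx fy hP hD; split=> // x y; split; rewrite /lagrangian.
  rewrite -(fineK gx) -(fineK fy).
  have := hD y; have := conjugate_neqNy y fp.
  case: (conjugate f y) => [r _| |] //; last by rewrite addeNy leNye.
  by move=> /(_ isT); rewrite -!EFinD lee_fin dotvDr dotvNr /=; lra.
rewrite -(fineK gx) -(fineK fy).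
have := hP x; have := gN x; case: (g x) => [r _| |] //; last first.
  by rewrite leey.
move=> /(_ isT); rewrite -!EFinD lee_fin !(dotv_adj K) dotvDr dotvNr /=.
by rewrite !(dotvC (hy *m _)); lra.
Qed.

End ConvexAnalysis.

(** * Real sequences *)

Lemma noninc_cvg (R : realType) (u : nat -> R) : (forall k, u k.+1 <= u k) -> (forall k, 0 <= u k) ->
  exists l : R, [/\ u @ \oo --> l, 0 <= l & forall k, l <= u k].
Proof.
move=> du u0.
have hu : {homo u : p q / (p <= q)%N >-> q <= p} by apply/nonincreasing_seqP.
have lb : has_lbound (range u) by exists 0 => _ [k _ <-].
have c := nonincreasing_cvgn hu lb.
exists (inf (range u)); split=> //.
  by apply: (cvgr_to_ge c); apply: nearW.
by move=> k; apply: ge_inf => //; exists k.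
Qed.

(* If L - (p + q) exceeds eta once, then p <= L - eta, q <= L - eta and
   L - (p + q) >= (1 - kap) eta / 8 persist: where L - (p + q) is small, so are u and v,
   while p and q are not, so that both decrease. *)
Lemma lagged_energy_cvg0 (R : realType) (p q u v nu a b : nat -> R) (L kap : R) :
  kap < 1 ->
  (forall k, 0 <= a k <= kap) -> (forall k, 0 <= b k <= kap) ->
  (forall k, [/\ 0 <= p k, 0 <= q k, 0 <= u k & 0 <= v k]) ->
  (forall k, p k.+1 <= (1 - a k) * p k + a k * u k) ->
  (forall k, q k.+1 <= (1 - b k) * q k + b k * v k) ->
  (forall k, u k + v k + (p k + q k) <= L + nu k) ->
  (forall k, 0 <= nu k) -> nu @ \oo --> 0 ->
  (forall e N, 0 < e -> exists2 k, (N <= k)%N & L - e < p k + q k) ->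
  (fun k => u k + v k) @ \oo --> 0.
Proof.
move=> kap1 ha hb nng hp hq hL nu_ge0 nu0 freq.
pose c := 1 - kap.
have c0 : 0 < c by rewrite subr_gt0.
have kap0 : 0 <= kap by case/andP: (ha 0%N) => /le_trans h /h.
have near_nu e : 0 < e -> \forall k \near \oo, nu k <= e.
  move=> e0; apply: filterS (cvgr0_norm_lt _ nu0 _ e0) => k /ltW.
  exact: le_trans (ler_norm _).
have main e : 0 < e -> 4 * e <= c * L -> \forall k \near \oo, L - e < p k + q k.
  move=> e0 eL.
  have ce : c * e <= e by rewrite ler_piMl ?(ltW e0) // /c; lra.
  have L0 : 0 < L by rewrite -(pmulr_rgt0 _ c0); lra.
  have cL : c * L <= L by rewrite ler_piMl ?(ltW L0) // /c; lra.
  have [N _ hN] : \forall k \near \oo, nu k <= c * e / 16.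
    by apply: near_nu; rewrite divr_gt0 ?mulr_gt0.
  exists N => // k /= Nk; rewrite ltNge; apply/negP => bad.
  have inv : forall j, [/\ p (k + j)%N <= L - e, q (k + j)%N <= L - e &
      c * e / 8 <= L - (p (k + j)%N + q (k + j)%N)].
    elim=> [|j [IHp IHq IHg]].
      by rewrite addn0; have [? ? _ _] := nng k; split; lra.
    rewrite addnS; move: (k + j)%N (leq_trans Nk (leq_addr j k)) IHp IHq IHg => i Ni.
    have := hp i; have := hq i; have := hL i; have := hN i Ni => /=.
    have := ha i; have := hb i; have := nu_ge0 i; have [] := nng i.
    move: (p i.+1) (q i.+1) (p i) (q i) (u i) (v i) (a i) (b i) (nu i).
    move=> p' q' P Q U V A B nn P0 Q0 U0 V0 nn0 /andP[B0 B1] /andP[A0 A1] nnB H Hq Hp P1 Q1 G.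
    have bound : forall X Y T, 0 <= T <= kap -> 0 <= X -> X <= L - e ->
        0 <= Y -> Y <= L + nn - X -> (1 - T) * X + T * Y <= L - e.
      move=> X Y T /andP[T0 T1] X0 X1 Y0 Y1.
      have : T * Y <= T * (L + nn - X) by rewrite ler_wpM2l.
      have [T2|T2] := lerP 0 (1 - 2 * T).
        have : (1 - 2 * T) * X <= (1 - 2 * T) * (L - e) by rewrite ler_wpM2l.
        have : T * (nn + 2 * e) <= T * L by rewrite ler_wpM2l //; lra.
        by lra.
      have : (1 - 2 * T) * X <= 0 by rewrite mulr_le0_ge0 // ltW.
      have : T * L <= kap * L by rewrite ler_wpM2r // ltW.
      have : T * nn <= nn by rewrite ler_piMl //; lra.
      by rewrite /c in eL *; lra.
    split.
    - by apply: le_trans Hp _; apply: bound => //; [rewrite A0|lra].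
    - by apply: le_trans Hq _; apply: bound => //; [rewrite B0|lra].
    (* If the gap [L - (P + Q)] is at most [e / 4], then [P >= U] and [Q >= V], so neither [p] nor
       [q] grows. Otherwise one step keeps the fraction [c] of the gap up to [nn]. *)
    - have [g4|g4] := lerP (L - (P + Q)) (e / 4).
        have : A * (U - P) <= 0 by rewrite mulr_ge0_le0 //; lra.
        have : B * (V - Q) <= 0 by rewrite mulr_ge0_le0 //; lra.
        by lra.
      have : A * U <= kap * U by rewrite ler_wpM2r.
      have : B * V <= kap * V by rewrite ler_wpM2r.
      have : 0 <= A * P by rewrite mulr_ge0.
      have : 0 <= B * Q by rewrite mulr_ge0.
      have : kap * (U + V) <= kap * (L - (P + Q) + nn) by rewrite ler_wpM2l //; lra.
      have : c * (e / 4) <= c * (L - (P + Q)) by rewrite ler_wpM2l ?(ltW c0) ?(ltW g4).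
      have : kap * nn <= nn by rewrite ler_piMl // ltW.
      by rewrite /c in nnB *; lra.
  have ce0 : 0 < c * e / 8 by rewrite divr_gt0 ?mulr_gt0.
  have [j kj jL] := freq _ k ce0.
  have := inv (j - k)%N; rewrite subnKC // => -[_ _]; lra.
(* For [L <= 0] nonnegativity of [p] and [q] is enough; otherwise [e] is shrunk to fit [main]. *)
have sub e : 0 < e -> \forall k \near \oo, L - e < p k + q k.
  move=> e0; have [L0|L0] := lerP L 0.
    by apply: nearW => k; have [? ? _ _] := nng k; lra.
  pose e' := Num.min e (c * L / 4).
  have e'0 : 0 < e' by rewrite lt_min e0 divr_gt0 ?mulr_gt0.
  have e'e : e' <= e by rewrite ge_min lexx.
  have e'L : 4 * e' <= c * L.
    have : e' <= c * L / 4 by rewrite ge_min lexx orbT.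
    by lra.
  by apply: filterS (main e' e'0 e'L) => k; lra.
apply/cvgr0Pnorm_lt => e e0.
have e2 : 0 < e / 2 by rewrite divr_gt0.
apply: filterS2 (sub _ e2) (near_nu _ (divr_gt0 e2 (ltr0n R 2))) => k h1 h2.
have := hL k; have [? ? ? ?] := nng k.
by rewrite ger0_norm ?addr_ge0 //; lra.
Qed.

(** * One iteration *)

Section EnergyStep.
Context {R : realType}.
Implicit Types (n m : nat).
Local Notation "`|< u >|" := (dotv u u) (at level 0, format "`|< u >|").

(** The multiple [a (1 - a)] of [e] arises when [xag] and [xmd] are eliminated from the iteration;
    the old and new averages then appear as [U + e] and [U + (1 - a) e]. *)
Lemma primal_identity n (U e p q r : 'rV[R]_n) (a t : R) :
  2 * dotv (p + q - (a * (1 - a)) *: e) (- (U + p + q))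
    + 2 * dotv (q - t *: r) p =
  `|<U>| + (1 - a) * `|<U + e>| - `|<U + p + q>|
    - (1 - a) * `|<U + (1 - a) *: e>| - a * `|<(1 - a) *: e>|
    + (a * (1 - a)) * `|<p + q>| - (a * (1 - a)) * `|<e - (p + q)>|
    - `|<p>| - `|<q>| - 2 * t * dotv r p.
Proof.
rewrite !dotv_lin (dotvC p U) (dotvC q U) (dotvC e U) (dotvC q p) (dotvC e p).
by rewrite (dotvC e q); ring.
Qed.

Lemma dual_identity m (V f d : 'rV[R]_m) (b : R) :
  2 * dotv (d - (b * (1 - b)) *: f) (- (V + d)) =
  `|<V>| + (1 - b) * `|<V + f>| - `|<V + d>| - (1 - b) * `|<V + (1 - b) *: f>|
    - (1 - b) * `|<d>| - b * `|<d - (1 - b) *: f>| - b * (1 - b) * `|<f>|.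
Proof. by rewrite !dotv_lin (dotvC d V) (dotvC f V) (dotvC f d); ring. Qed.

(** For given [s] the best constant is [s / (1 + s)], and [c <= s * (1 - c)] says that [c] does not
    exceed it. *)
Lemma dotv_split_le n (p q : 'rV[R]_n) (c s : R) :
  c < 1 -> c <= s * (1 - c) -> c * `|<p + q>| <= s * `|<p>| + `|<q>|.
Proof.
move=> c1 cs; have c0 : 0 < 1 - c by rewrite subr_gt0.
rewrite -subr_ge0 -(pmulr_rge0 _ c0).
have -> : (1 - c) * (s * `|<p>| + `|<q>| - c * `|<p + q>|) =
    `|<(1 - c) *: q + (- c) *: p>| + (s * (1 - c) - c) * `|<p>|.
  by rewrite !dotv_lin (dotvC q p); ring.
by rewrite addr_ge0 ?mulr_ge0 ?dotv_ge0 ?subr_ge0.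
Qed.

(** The budget of [p] has three shares: [t ^+ 2 * a] completes the square with [r], [delta] is kept
    for the linesearch cross term, and [a + eps] together with the square of [q] pays for the
    positive [p + q] term and leaves [eps / 4] of it. *)
Lemma primal_decrease n (U e p q r : 'rV[R]_n) (a a' t delta eps : R) :
  0 < a' -> a' <= a -> a' < 1 -> 0 < eps -> eps <= 1 ->
  delta + t ^+ 2 * a + a + eps <= 1 ->
  2 * dotv (p + q - (a' * (1 - a')) *: e) (- (U + p + q))
    + 2 * dotv (q - (t * a) *: r) p + delta * `|<p>| <=
  `|<U>| + (1 - a') * `|<U + e>| - `|<U + p + q>|
    - (1 - a') * `|<U + (1 - a') *: e>| - a' * `|<(1 - a') *: e>| + a * `|<r>|
    - eps / 4 * `|<p + q>| - (a' * (1 - a')) * `|<e - (p + q)>|.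
Proof.
move=> a'0 a'a a'1 e0 e1 hd; rewrite primal_identity.
have h1 : 0 <= a * `|<r>| + t ^+ 2 * a * `|<p>| + 2 * (t * a) * dotv r p.
  have -> : a * `|<r>| + t ^+ 2 * a * `|<p>| + 2 * (t * a) * dotv r p =
    a * `|<r + t *: p>| by rewrite dotv_sqrDZ; ring.
  by rewrite mulr_ge0 ?dotv_ge0 //; lra.
have h2 : (a' * (1 - a') + eps / 4) * `|<p + q>| <= (a + eps) * `|<p>| + `|<q>|.
  apply: dotv_split_le.
    by have := sqr_ge0 (a' - 1 / 2); lra.
  apply: (@le_trans _ _ ((a' + eps) * (1 - (a' * (1 - a') + eps / 4)))); last first.
    rewrite ler_wpM2r ?lerD2r //.
    by have := sqr_ge0 (a' - 1 / 2); lra.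
  have : 0 <= a' ^+ 3 by rewrite exprn_ge0 // ltW.
  have : 0 <= eps * (a' - 1 / 2) ^+ 2 by rewrite mulr_ge0 ?sqr_ge0 ?ltW.
  have : eps * eps <= eps * 1 by rewrite ler_wpM2l // ltW.
  have : eps * a' <= eps * 1 by rewrite ler_wpM2l // ltW.
  by lra.
have := dotv_ge0 p => p0.
have : (delta + t ^+ 2 * a + a + eps) * `|<p>| <= 1 * `|<p>| by rewrite ler_wpM2r.
by lra.
Qed.

Lemma dual_decrease m (V f d : 'rV[R]_m) (b delta eps : R) :
  0 < b -> delta + b + eps <= 1 ->
  2 * dotv (d - (b * (1 - b)) *: f) (- (V + d)) + delta * `|<d>| <=
  `|<V>| + (1 - b) * `|<V + f>| - `|<V + d>| - (1 - b) * `|<V + (1 - b) *: f>|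
    - (eps * `|<d>| + b * (1 - b) * `|<f>|).
Proof.
move=> b0 hd; rewrite dual_identity.
have : 0 <= b * `|<d - (1 - b) *: f>| by rewrite mulr_ge0 ?dotv_ge0 ?ltW.
have : (delta + b + eps) * `|<d>| <= 1 * `|<d>| by rewrite ler_wpM2r ?dotv_ge0.
by lra.
Qed.

(* U = x_j - hx, e = xag_j - x_j, q = xbar_j - x_j, p = x_(j+1) - xbar_j,
   r = xag_j - x_(j-1), V = y_j - hy, f = yag_j - y_j, d = y_(j+1) - y_j; sh, S and W are
   the images of hy, V and d under K^T, and g1, g2, g3 the values of g at x_(j-1), x_j, x_(j+1). *)
Lemma energy_step n m (U e p q r sh S W hx : 'rV[R]_n) (V f d : 'rV[R]_m)
    (a a' b th tau beta delta eps g0 g1 g2 g3 f0 f3 : R) :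
  0 < a' -> a' <= a -> a' < 1 -> 0 < b -> 0 < eps -> eps <= 1 ->
  0 < beta -> 0 < delta -> 0 <= tau ->
  delta + th ^+ 2 * a + a + eps <= 1 -> delta + b + eps <= 1 ->
  tau * (g3 - g0) <=
    dotv (p + q - (a' * (1 - a')) *: e + tau *: (sh + S + W)) (- (U + p + q)) ->
  tau * (g2 - g3) <= dotv (q - (th * a) *: r + tau *: (sh + S)) (p + q) ->
  tau * th * (g2 - g1) <= dotv (q - (th * a) *: r + tau *: (sh + S)) (- q) ->
  tau * (f3 - f0) <= beta^-1 * dotv (d - (b * (1 - b)) *: f) (- (V + d))
    + tau * dotv (hx + U + q) (S + W) ->
  beta * tau ^+ 2 * `|<W>| <= delta ^+ 2 * `|<d>| ->
  0 <= f3 - f0 - dotv hx (S + W) ->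
  `|<U + p + q>| + (1 - a') * `|<U + (1 - a') *: e>|
    + beta^-1 * (`|<V + d>| + (1 - b) * `|<V + (1 - b) *: f>|)
    + a' * `|<(1 - a') *: e>| + 2 * (tau * (1 + th)) * (g2 - g0 + dotv sh U)
    + (eps / 4 * `|<p + q>| + a' * (1 - a') * `|<e - (p + q)>|
       + beta^-1 * (eps * `|<d>| + b * (1 - b) * `|<f>|)) <=
  `|<U>| + (1 - a') * `|<U + e>| + beta^-1 * (`|<V>| + (1 - b) * `|<V + f>|)
    + a * `|<r>| + 2 * tau * (th * (g1 - g0) + dotv sh (th *: U - q)).
Proof.
move=> a'0 a'a a'1 b0 e0 e1 be0 de0 tau0 hda hdb I II III IV ls D0.
have hp := primal_decrease U e p q r a'0 a'a a'1 e0 e1 hda.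
have ib : 0 < beta^-1 by rewrite invr_gt0.
have := dual_decrease V f d b0 hdb; rewrite -(ler_pM2l ib) => hd.
(* By the linesearch test [ls], Young's inequality splits this term exactly into the [delta] shares
   reserved in [hp] and [hd]. *)
have cross : - (2 * tau * dotv W p) <= delta * `|<p>| + beta^-1 * (delta * `|<d>|).
  have := dotv_young (- (tau / delta)) W p.
  rewrite -(ler_pM2l de0).
  have : delta^-1 * (tau ^+ 2 * `|<W>|) <= beta^-1 * (delta * `|<d>|).
    rewrite ler_pdivrMl // mulrCA ler_pdivlMl //.
    by move: ls; rewrite expr2; lra.
  have -> : delta * (2 * - (tau / delta) * dotv W p) = - (2 * tau * dotv W p).
    by field; rewrite gt_eqF.
  have -> : delta * ((- (tau / delta)) ^+ 2 * `|<W>| + `|<p>|) =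
    delta^-1 * (tau ^+ 2 * `|<W>|) + delta * `|<p>| by field; rewrite gt_eqF.
  by lra.
(* Twice the sum of [I] to [IV] and [tau] times [D0]: [g3] and [f3] cancel, and [g2] is left with
   weight [tau * (1 + th)]. *)
have coupled : 2 * (tau * (1 + th)) * (g2 - g0 + dotv sh U) <=
    2 * dotv (p + q - (a' * (1 - a')) *: e) (- (U + p + q))
    + 2 * dotv (q - (th * a) *: r) p
    + beta^-1 * (2 * dotv (d - (b * (1 - b)) *: f) (- (V + d)))
    - 2 * tau * dotv W p
    + 2 * tau * (th * (g1 - g0) + dotv sh (th *: U - q)).
  have := mulr_ge0 tau0 D0; move: I II III IV.
  rewrite (dotvDl (p + q - _)) !(dotvDl _ (tau *: (sh + S))).
  rewrite (dotvDr p q) (dotvNr q).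
  set X1 := dotv (_ - _ *: e) _; set Y1 := dotv (d - _) _.
  set X2 := dotv (q - _) p; set X3 := dotv (q - _) q.
  rewrite !dotv_lin (dotvC q S) (dotvC U S) (dotvC q W) (dotvC U W).
  clearbody X1 Y1 X2 X3; clear.
  by lra.
by clear I II III IV ls D0; lra.
Qed.

End EnergyStep.

(** * The iterates *)

Section Run.
Context (R : realType) (n m : nat).
Variables (g : 'rV[R]_n -> \bar R) (f : 'rV[R]_m -> \bar R) (K : 'M[R]_(n, m)).
Variables (a b : nat -> R) (beta mu theta delta : R).
Variables (x xag xmd xbar : nat -> 'rV[R]_n) (y yag ymd : nat -> 'rV[R]_m).
Variables (tau th : nat -> R).
Hypothesis hg : proper_closed_convex g.
Hypothesis hf : proper_closed_convex f.
Hypothesis hsaddle : exists hx hy, saddle_point g f K hx hy.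
Hypothesis hab : forall k, (1 <= k)%N -> 0 < a k < 1 /\ 0 < b k < 1.
Hypothesis hmon : forall k, (1 <= k)%N -> a k.+1 <= a k /\ b k.+1 <= b k.
Hypothesis htau0 : 0 < tau 0%N.
Hypothesis hbeta : 0 < beta.
Hypothesis hmu : 0 < mu < 1.
Hypothesis hdelta : 0 < delta < 1.
Hypothesis hcond : forall k, (1 <= k)%N ->
  delta + theta ^+ 2 * a k + a k < 1 /\ delta + b k < 1.
Hypothesis hth0 : th 0%N = 1.
Hypothesis hiter : forall k : nat,
     xag k.+1 = (1 - a k.+1) *: xag k + a k.+1 *: x k /\
     yag k.+2 = (1 - b k.+2) *: yag k.+1 + b k.+2 *: y k.+1 /\
     xmd k.+1 = (1 - a k.+1) *: x k + a k.+1 *: xag k.+1 /\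
     ymd k.+2 = (1 - b k.+2) *: y k.+1 + b k.+2 *: yag k.+2 /\
     is_prox g (tau k) (xmd k.+1 - tau k *: (y k.+1 *m K^T)) (x k.+1) /\
     exists i : nat,
       tau k.+1 = tau k * Num.sqrt (1 + th k) * mu ^+ i /\
       th k.+1 = tau k.+1 / tau k /\
       xbar k.+1 = x k.+1 + th k.+1 *: (x k.+1 - x k) /\
       is_prox (conjugate f) (beta * tau k.+1)
         (ymd k.+2 + (beta * tau k.+1) *: (xbar k.+1 *m K)) (y k.+2) /\
       Num.sqrt beta * tau k.+1 * enorm (y k.+2 *m K^T - y k.+1 *m K^T)
         <= delta * enorm (y k.+2 - y k.+1) /\
       (forall (j : nat) (yc : 'rV[R]_m), (j < i)%N ->
          let t := tau k * Num.sqrt (1 + th k) * mu ^+ j in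
          is_prox (conjugate f) (beta * t)
            (ymd k.+2 + (beta * t) *:
               ((x k.+1 + (t / tau k) *: (x k.+1 - x k)) *m K)) yc ->
          ~ (Num.sqrt beta * t * enorm (yc *m K^T - y k.+1 *m K^T)
               <= delta * enorm (yc - y k.+1))).
Hypothesis hthle : forall k, th k <= theta.

Let fP : proper_fun f. Proof. by case: hf. Qed.

(** * Step sizes and parameters *)

Lemma mu_gt0 : 0 < mu. Proof. by case/andP: hmu. Qed.
Lemma mu_lt1 : mu < 1. Proof. by case/andP: hmu. Qed.
Lemma delta_gt0 : 0 < delta. Proof. by case/andP: hdelta. Qed.

Lemma tau_th_gt0 k : 0 < tau k /\ 0 < th k.
Proof.
elim: k => [|k [t0 th1]]; first by rewrite hth0.
have [_ [_ [_ [_ [_ [i [tE [thE _]]]]]]]] := hiter k.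
have : 0 < tau k.+1.
  by rewrite tE !mulr_gt0 ?exprn_gt0 ?mu_gt0 // sqrtr_gt0 addr_gt0.
by move=> h; split=> //; rewrite thE divr_gt0.
Qed.

Lemma tau_gt0 k : 0 < tau k. Proof. exact: (tau_th_gt0 k).1. Qed.
Lemma th_gt0 k : 0 < th k. Proof. exact: (tau_th_gt0 k).2. Qed.

Lemma tauE k : tau k.+1 = th k.+1 * tau k.
Proof.
have [_ [_ [_ [_ [_ [i [_ [-> _]]]]]]]] := hiter k.
by rewrite divfK // gt_eqF ?tau_gt0.
Qed.

Lemma a_gt0 k : 0 < a k.+1. Proof. by have [/andP[]] := hab (ltn0Sn k). Qed.
Lemma a_lt1 k : a k.+1 < 1. Proof. by have [/andP[]] := hab (ltn0Sn k). Qed.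
Lemma b_gt0 k : 0 < b k.+1. Proof. by have [_ /andP[]] := hab (ltn0Sn k). Qed.
Lemma b_lt1 k : b k.+1 < 1. Proof. by have [_ /andP[]] := hab (ltn0Sn k). Qed.
Lemma a_noninc k : a k.+2 <= a k.+1. Proof. exact: (hmon (ltn0Sn k)).1. Qed.
Lemma b_noninc k : b k.+2 <= b k.+1. Proof. exact: (hmon (ltn0Sn k)).2. Qed.
Lemma a_le1 k : a k.+1 <= a 1%N.
Proof. by elim: k => // k /(le_trans (a_noninc k)). Qed.
Lemma b_le1 k : b k.+1 <= b 1%N.
Proof. by elim: k => // k /(le_trans (b_noninc k)). Qed.

(** The sequences are nonincreasing, so the slack of the conditions at index 1 works for every
    [k]. *)
Lemma margin : exists eps, [/\ 0 < eps, eps <= 1,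
  forall k, delta + th k.+1 ^+ 2 * a k.+1 + a k.+1 + eps <= 1 &
  forall k, delta + b k.+1 + eps <= 1].
Proof.
have [h1 h2] := hcond (leqnn 1).
pose e1 := 1 - (delta + theta ^+ 2 * a 1%N + a 1%N); pose e2 := 1 - (delta + b 1%N).
exists (Num.min e1 e2).
have m1 : Num.min e1 e2 <= e1 by rewrite ge_min lexx.
have m2 : Num.min e1 e2 <= e2 by rewrite ge_min lexx orbT.
split; first by rewrite lt_min !subr_gt0 h1.
- by apply: le_trans m2 _; rewrite /e2; have := b_gt0 0; have := delta_gt0; lra.
- move=> k; have := a_le1 k; have := a_gt0 k.
  have : th k.+1 ^+ 2 * a k.+1 <= theta ^+ 2 * a 1%N.
    rewrite ler_pM ?sqr_ge0 ?(ltW (a_gt0 k)) ?a_le1 //.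
    have t0 : 0 <= theta := ltW (lt_le_trans (th_gt0 0) (hthle 0)).
    by rewrite ler_sqr ?nnegrE ?hthle ?(ltW (th_gt0 _)).
  by rewrite /e1 in m1; lra.
- by move=> k; have := b_le1 k; rewrite /e2 in m2; lra.
Qed.

(** * The iteration as residuals and variational inequalities *)

Lemma xresidE k : x k.+1 - xmd k.+1 =
  x k.+1 - x k - (a k.+1 * (1 - a k.+1)) *: (xag k - x k).
Proof.
have [-> [_ [-> _]]] := hiter k.
by apply/rowP => i; rewrite !mxE; ring.
Qed.

Lemma yresidE k : y k.+2 - ymd k.+2 =
  y k.+2 - y k.+1 - (b k.+2 * (1 - b k.+2)) *: (yag k.+1 - y k.+1).
Proof.
have [_ [-> [_ [-> _]]]] := hiter k.
by apply/rowP => i; rewrite !mxE; ring.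
Qed.

Lemma g_fin k : g (x k.+1) \is a fin_num.
Proof.
have [_ [_ [_ [_ [pr _]]]]] := hiter k.
have [hx [hy [gfin _ _]]] := hsaddle.
by have [[gN _] _ _] := hg; exact: prox_dom gN pr gfin.
Qed.

Lemma f_fin k : conjugate f (y k.+2) \is a fin_num.
Proof.
have [_ [_ [_ [_ [_ [i [_ [_ [_ [pr _]]]]]]]]]] := hiter k.
have [hx [hy [_ ffin _]]] := hsaddle.
by apply: prox_dom pr ffin => z; exact: conjugate_neqNy.
Qed.

Lemma xprox_ineq k z : g z \is a fin_num ->
  tau k * (fine (g (x k.+1)) - fine (g z)) <=
  dotv (x k.+1 - xmd k.+1 + tau k *: (y k.+1 *m K^T)) (z - x k.+1).
Proof.
have [_ [_ [_ [_ [pr _]]]]] := hiter k => gz.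
have [_ _ cv] := hg.
have := prox_ineq cv (tau_gt0 k) pr (g_fin k) gz.
by rewrite opprB addrA addrAC.
Qed.

Lemma yprox_ineq k z : conjugate f z \is a fin_num ->
  tau k.+1 * (fine (conjugate f (y k.+2)) - fine (conjugate f z)) <=
  beta^-1 * dotv (y k.+2 - ymd k.+2) (z - y k.+2)
    - tau k.+1 * dotv (xbar k.+1 *m K) (z - y k.+2).
Proof.
have [_ [_ [_ [_ [_ [i [_ [_ [_ [pr _]]]]]]]]]] := hiter k => fz.
have := prox_ineq (conjugate_convex fP) (mulr_gt0 hbeta (tau_gt0 k.+1)) pr (f_fin k) fz.
rewrite opprD addrA (dotvDl _ (- (_ *: _))) (dotvNl (_ *: _)) dotvZl => H.
have ib : 0 <= beta^-1 by rewrite invr_ge0 ltW.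
have := ler_wpM2l ib H.
by rewrite [in X in _ <= X -> _]mulrBr !(mulrA beta^-1) mulVf ?gt_eqF // !mul1r.
Qed.

Lemma xag_step k : xag k.+1 = (1 - a k.+1) *: xag k + a k.+1 *: x k.
Proof. by have [-> _] := hiter k. Qed.

Lemma yag_step k : yag k.+2 = (1 - b k.+2) *: yag k.+1 + b k.+2 *: y k.+1.
Proof. by have [_ [-> _]] := hiter k. Qed.

Lemma xbarE k : xbar k.+1 = x k.+1 + th k.+1 *: (x k.+1 - x k).
Proof. by have [_ [_ [_ [_ [_ [i [_ [_ [-> _]]]]]]]]] := hiter k. Qed.

Lemma linesearch_sq k :
  beta * tau k.+1 ^+ 2 *
    dotv ((y k.+2 - y k.+1) *m K^T) ((y k.+2 - y k.+1) *m K^T) <=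
  delta ^+ 2 * dotv (y k.+2 - y k.+1) (y k.+2 - y k.+1).
Proof.
have [_ [_ [_ [_ [_ [i [_ [_ [_ [_ [ls _]]]]]]]]]]] := hiter k.
have t0 := ltW (tau_gt0 k.+1).
move: ls; rewrite -mulmxBl -(ler_pXn2r (n := 2)) ?nnegrE ?mulr_ge0 ?enorm_ge0 ?sqrtr_ge0 ?(ltW delta_gt0) //.
by rewrite !exprMn !enormK sqr_sqrtr // ltW.
Qed.

(** * Energy decrease *)

Section Energy.
Variables (eps : R) (hx : 'rV[R]_n) (hy : 'rV[R]_m).
Hypothesis eps_gt0 : 0 < eps.
Hypothesis eps_le1 : eps <= 1.
Hypothesis eps_a : forall k, delta + th k.+1 ^+ 2 * a k.+1 + a k.+1 + eps <= 1.
Hypothesis eps_b : forall k, delta + b k.+1 + eps <= 1.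
Hypothesis sad : saddle_point g f K hx hy.

(* L(z, hy) - L(hx, hy), the terms in f^* cancelling *)
Definition pgap z := fine (g z) - fine (g hx) + dotv (hy *m K^T) (z - hx).

(* The weights carry their own indices: one iteration decreases [wdist] with the
   weights kept fixed, and these change only afterwards. *)
Definition wdist (ka kb k : nat) : R :=
  dotv (x k - hx) (x k - hx) + (1 - a ka) * dotv (xag k - hx) (xag k - hx)
  + beta^-1 * (dotv (y k - hy) (y k - hy) + (1 - b kb) * dotv (yag k - hy) (yag k - hy)).

(** The terms that one use of [energy_step] leaves over and the next one consumes. *)
Definition carry k : R :=
  a k.+2 * dotv (xag k.+2 - x k.+1) (xag k.+2 - x k.+1)
  + 2 * (tau k.+1 * (1 + th k.+1)) * pgap (x k.+1).

(** The last term is the gain from backtracking: it replaces the weight [tau k.+2 * th k.+2],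
    produced by the step, by the weight of [carry k], and its factor is zero when the first trial is
    accepted. *)
Definition loss k : R :=
  eps / 4 * dotv (x k.+3 - x k.+2) (x k.+3 - x k.+2)
  + a k.+3 * (1 - a k.+3) * dotv (xag k.+2 - x k.+3) (xag k.+2 - x k.+3)
  + beta^-1 * (eps * dotv (y k.+3 - y k.+2) (y k.+3 - y k.+2)
     + b k.+3 * (1 - b k.+3) * dotv (yag k.+2 - y k.+2) (yag k.+2 - y k.+2))
  + 2 * (tau k.+1 * (1 + th k.+1) - tau k.+2 * th k.+2) * pgap (x k.+1).

(** This is [energy_step] at [j = k + 2]. The proximal inequality of [x k.+2] is tested at [x k.+3]
    and, with weight [th k.+2], at [x k.+1]; hence the start at [j = 2], since [x 0] need not lie in
    the domain of [g]. *)
Lemma energy_ineq k :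
  wdist k.+3 k.+3 k.+3 + carry k.+1 + loss k <= wdist k.+3 k.+3 k.+2 + carry k.
Proof.
have [gfin ffin _] := sad.
have I := xprox_ineq k.+2 gfin.
have II := xprox_ineq k.+1 (g_fin k.+2).
have III := xprox_ineq k.+1 (g_fin k).
have IV := yprox_ineq k.+1 ffin.
have D0 := saddle_gap_dual sad (f_fin k.+1).
move: I II III IV D0 (linesearch_sq k.+1).
rewrite !xresidE !yresidE.
set U := x k.+2 - hx; set e := xag k.+2 - x k.+2.
set q := th k.+2 *: (x k.+2 - x k.+1); set p := x k.+3 - xbar k.+2.
set r := xag k.+2 - x k.+1; set V := y k.+2 - hy; set v := yag k.+2 - y k.+2.
set d := y k.+3 - y k.+2.
have pq : p + q = x k.+3 - x k.+2.
  by rewrite /p /q xbarE; apply/rowP => i; rewrite !mxE; ring.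
move=> I II III IV D0 ls.
have t2 : 0 <= th k.+2 := ltW (th_gt0 k.+2).
(* Multiplication by [th k.+2] turns [tau k.+1] into [tau k.+2] and the increment of [x] into the
   extrapolation [q]. *)
have qr : th k.+2 *: (x k.+2 - x k.+1 - (a k.+2 * (1 - a k.+2)) *: (xag k.+1 - x k.+1)
     + tau k.+1 *: (y k.+2 *m K^T)) =
   q - (th k.+2 * a k.+2) *: r + tau k.+2 *: (y k.+2 *m K^T).
  rewrite (tauE k.+1) /q /r (xag_step k.+1).
  by apply/rowP => i; rewrite !mxE; ring.
have := @energy_step R n m U e p q r (hy *m K^T) (V *m K^T) (d *m K^T) hx V v d
  (a k.+2) (a k.+3) (b k.+3) (th k.+2) (tau k.+2) beta delta eps
  (fine (g hx)) (fine (g (x k.+1))) (fine (g (x k.+2))) (fine (g (x k.+3)))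
  (fine (conjugate f hy)) (fine (conjugate f (y k.+3)))
  (a_gt0 _) (a_noninc _) (a_lt1 _) (b_gt0 _) eps_gt0 eps_le1 hbeta delta_gt0
  (ltW (tau_gt0 _)) (eps_a _) (eps_b _).
have -> : U + p + q = x k.+3 - hx by rewrite -addrA pq /U addrC subrKA.
have -> : V + d = y k.+3 - hy by rewrite /V /d addrC subrKA.
have -> : hx + U + q = xbar k.+2 by rewrite /U addrC subrKC xbarE addrC.
have -> : U + e = xag k.+2 - hx by rewrite /U /e addrC subrKA.
have -> : V + v = yag k.+2 - hy by rewrite /V /v addrC subrKA.
have -> : U + (1 - a k.+3) *: e = xag k.+3 - hx.
  by rewrite (xag_step k.+2) /U /e; apply/rowP => i; rewrite !mxE; ring.
have -> : V + (1 - b k.+3) *: v = yag k.+3 - hy.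
  by rewrite (yag_step k.+1) /V /v; apply/rowP => i; rewrite !mxE; ring.
have -> : (1 - a k.+3) *: e = xag k.+3 - x k.+2.
  by rewrite (xag_step k.+2) /e; apply/rowP => i; rewrite !mxE; ring.
have -> : e - (p + q) = xag k.+2 - x k.+3.
  by rewrite pq /e; apply/rowP => i; rewrite !mxE; ring.
have -> : th k.+2 *: U - q = th k.+2 *: (x k.+1 - hx).
  by rewrite /U /q; apply/rowP => i; rewrite !mxE; ring.
rewrite pq -!mulmxDl.
have -> : hy + V + d = y k.+3 by apply/rowP => i; rewrite /V /d !mxE; ring.
have -> : hy + V = y k.+2 by rewrite /V subrKC.
have -> : V + d = y k.+3 - hy by rewrite /V /d addrC subrKA.
have II' : tau k.+2 * (fine (g (x k.+2)) - fine (g (x k.+3))) <=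
    dotv (q - (th k.+2 * a k.+2) *: r + tau k.+2 *: (y k.+2 *m K^T)) (x k.+3 - x k.+2).
  by rewrite -qr dotvZl (tauE k.+1) -mulrA ler_wpM2l.
have III' : tau k.+2 * th k.+2 * (fine (g (x k.+2)) - fine (g (x k.+1))) <=
    dotv (q - (th k.+2 * a k.+2) *: r + tau k.+2 *: (y k.+2 *m K^T)) (- q).
  rewrite -qr dotvZl /q -(scalerN (th _)) (opprB (x k.+2)) dotvZr (tauE k.+1) -!mulrA.
  by rewrite [tau _ * _]mulrCA !ler_wpM2l.
rewrite opprB [X in beta^-1 * dotv _ X]opprB => H.
have IV' : tau k.+2 * (fine (conjugate f (y k.+3)) - fine (conjugate f hy)) <=
    beta^-1 * dotv (d - (b k.+3 * (1 - b k.+3)) *: v) (hy - y k.+3)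
    + tau k.+2 * dotv (xbar k.+2) ((y k.+3 - hy) *m K^T).
  by apply: le_trans IV _; rewrite -dotv_adj -(opprB (y k.+3) hy) !dotvNr !mulrN opprK.
have D0' : 0 <= fine (conjugate f (y k.+3)) - fine (conjugate f hy)
    - dotv hx ((y k.+3 - hy) *m K^T) by rewrite -dotv_adj.
have {H} := H I II' III' IV' ls D0'.
rewrite /wdist /carry /loss /pgap dotvZr -/U -/V -/e -/r -/d -/v.
by lra.
Qed.

Lemma pgap_ge0 k : 0 <= pgap (x k.+1).
Proof. exact: saddle_gap_primal sad (g_fin k). Qed.

(** The square root in the first trial step gives equality up to the factor [mu ^+ (2 * i)], where
    [i] counts the rejected trials. *)
Lemma tauth_le k : tau k.+1 * th k.+1 <= tau k * (1 + th k).
Proof.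
have [_ [_ [_ [_ [_ [i [tE [thE _]]]]]]]] := hiter k.
have t0 := tau_gt0 k; have s0 : 0 <= 1 + th k by rewrite addr_ge0 ?ltW ?th_gt0.
have -> : tau k.+1 * th k.+1 = tau k * (1 + th k) * (mu ^+ i) ^+ 2.
  rewrite thE tE; have := sqr_sqrtr s0; set r := Num.sqrt _ => <-.
  by field; rewrite gt_eqF.
rewrite ler_piMr ?mulr_ge0 ?(ltW t0) // -exprM exprn_ile1 ?(ltW mu_gt0) //.
exact: ltW mu_lt1.
Qed.

(** Expressed through [tau] because the number of rejected trials is only known to exist; as
    [0 < mu < 1], the two descriptions agree. *)
Definition backtracks k := tau k.+1 != tau k * Num.sqrt (1 + th k).

Lemma tauth_backtracks k : backtracks k ->
  tau k.+1 * th k.+1 <= mu ^+ 2 * (tau k * (1 + th k)).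
Proof.
have [_ [_ [_ [_ [_ [i [tE [thE _]]]]]]]] := hiter k.
have t0 := tau_gt0 k; have s0 : 0 <= 1 + th k by rewrite addr_ge0 ?ltW ?th_gt0.
have -> : tau k.+1 * th k.+1 = (mu ^+ i) ^+ 2 * (tau k * (1 + th k)).
  rewrite thE tE; have := sqr_sqrtr s0; set r := Num.sqrt _ => <-.
  by field; rewrite gt_eqF.
rewrite /backtracks tE; case: i {tE} => [|i _]; first by rewrite expr0 mulr1 eqxx.
rewrite ler_wpM2r ?mulr_ge0 ?(ltW t0) // ler_sqr ?nnegrE ?exprn_ge0 ?(ltW mu_gt0) //.
by rewrite exprS ler_piMr ?(ltW mu_gt0) // exprn_ile1 ?(ltW mu_gt0) ?(ltW mu_lt1).
Qed.

Lemma sqr_th_nobacktrack k : ~ backtracks k -> th k.+1 ^+ 2 = 1 + th k.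
Proof.
move=> /negP; rewrite negbK => /eqP tE.
have [_ [_ [_ [_ [_ [i [_ [-> _]]]]]]]] := hiter k.
rewrite tE mulrAC divff ?gt_eqF ?tau_gt0 // mul1r sqr_sqrtr //.
by rewrite addr_ge0 ?ltW ?th_gt0.
Qed.

Lemma wdistE ka kb k : dotv (x k - hx) (x k - hx)
  + (1 - a ka.+1) * dotv (xag k - hx) (xag k - hx)
  + beta^-1 * dotv (y k - hy) (y k - hy)
  + beta^-1 * ((1 - b kb.+1) * dotv (yag k - hy) (yag k - hy))
  = wdist ka.+1 kb.+1 k.
Proof. by rewrite /wdist; ring. Qed.

Lemma ibeta_gt0 : 0 < beta^-1. Proof. by rewrite invr_gt0. Qed.

Lemma carry_ge0 k : 0 <= carry k.
Proof.
rewrite /carry addr_ge0 ?mulr_ge0 ?dotv_ge0 ?pgap_ge0 ?(ltW (tau_gt0 _)) //.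
  exact: ltW (a_gt0 _).
by rewrite addr_ge0 // ltW ?th_gt0.
Qed.

Lemma loss_ge_sum k : [/\ 0 <= loss k,
  eps / 4 * dotv (x k.+3 - x k.+2) (x k.+3 - x k.+2) <= loss k,
  a k.+3 * (1 - a k.+3) * dotv (xag k.+2 - x k.+3) (xag k.+2 - x k.+3) <= loss k &
  [/\ beta^-1 * (eps * dotv (y k.+3 - y k.+2) (y k.+3 - y k.+2)) <= loss k,
   beta^-1 * (b k.+3 * (1 - b k.+3) * dotv (yag k.+2 - y k.+2) (yag k.+2 - y k.+2)) <= loss k &
   2 * (tau k.+1 * (1 + th k.+1) - tau k.+2 * th k.+2) * pgap (x k.+1) <= loss k]].
Proof.
rewrite /loss.
set t1 := _ * dotv (x k.+3 - _) _.
set t2 := _ * dotv (xag k.+2 - _) _.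
rewrite (mulrDr beta^-1); set t3 := beta^-1 * (eps * _); set t4 := beta^-1 * (_ * dotv (yag _ - _) _).
set t5 := _ * pgap _.
have ib := ltW ibeta_gt0; have e0 := ltW eps_gt0.
have p1 : 0 <= t1 by rewrite mulr_ge0 ?dotv_ge0 ?divr_ge0.
have p2 : 0 <= t2.
  by rewrite mulr_ge0 ?dotv_ge0 ?mulr_ge0 ?(ltW (a_gt0 _)) ?subr_ge0 ?(ltW (a_lt1 _)).
have p3 : 0 <= t3 by rewrite !mulr_ge0 ?dotv_ge0.
have p4 : 0 <= t4.
  apply: mulr_ge0 => //.
  by rewrite mulr_ge0 ?dotv_ge0 ?mulr_ge0 ?(ltW (b_gt0 _)) ?subr_ge0 ?(ltW (b_lt1 _)).
have p5 : 0 <= t5.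
  by rewrite mulr_ge0 ?pgap_ge0 // mulr_ge0 // subr_ge0 tauth_le.
by split; [lra|lra|lra|split; lra].
Qed.

(** * A nonincreasing rescaled energy *)

Definition scale k := ((1 - a k.+3) * (1 - b k.+3))^-1.
Definition Phi k := scale k * (wdist k.+3 k.+3 k.+2 + carry k).

Let A_gt0 k : 0 < 1 - a k.+1. Proof. by rewrite subr_gt0 a_lt1. Qed.
Let B_gt0 k : 0 < 1 - b k.+1. Proof. by rewrite subr_gt0 b_lt1. Qed.

Lemma scale_ge1 k : 1 <= scale k.
Proof.
rewrite /scale invf_ge1 ?mulr_gt0 // mulr_ile1 ?(ltW (A_gt0 _)) ?(ltW (B_gt0 _)) //.
  by rewrite gerBl ltW ?a_gt0.
by rewrite gerBl ltW ?b_gt0.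
Qed.

Lemma wdist_ge0 ka kb k : 0 <= wdist ka.+1 kb.+1 k.
Proof.
rewrite -wdistE !addr_ge0 ?mulr_ge0 ?dotv_ge0 ?(ltW ibeta_gt0) //.
- exact: ltW (A_gt0 _).
- exact: ltW (B_gt0 _).
Qed.

(* The weights 1 - a_k and 1 - b_k increase with k; after division by their
   product every term has a nonincreasing weight. *)
Lemma rescale_le k z : scale k.+1 * (wdist k.+4 k.+4 z + carry k.+1) <=
  scale k * (wdist k.+3 k.+3 z + carry k.+1).
Proof.
have c0 := carry_ge0 k.+1; move: (carry k.+1) c0 => c c0.
rewrite -!wdistE /scale.
set u := dotv _ _; set w := dotv (xag z - _) _; set v := beta^-1 * dotv (y _ - _) _.
set s := dotv (yag _ - _) _.
have u0 : 0 <= u := dotv_ge0 _; have w0 : 0 <= w := dotv_ge0 _.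
have v0 : 0 <= v by rewrite mulr_ge0 ?dotv_ge0 ?(ltW ibeta_gt0).
have s0 : 0 <= beta^-1 * s by rewrite mulr_ge0 ?dotv_ge0 ?(ltW ibeta_gt0).
have A0 := A_gt0 k.+2; have B0 := B_gt0 k.+2.
have A0' := A_gt0 k.+3; have B0' := B_gt0 k.+3.
have AA : (1 - a k.+4)^-1 <= (1 - a k.+3)^-1.
  by rewrite lef_pV2 ?posrE // lerD2l lerN2 a_noninc.
have BB : (1 - b k.+4)^-1 <= (1 - b k.+3)^-1.
  by rewrite lef_pV2 ?posrE // lerD2l lerN2 b_noninc.
have split_sum (A B : R) : 0 < A -> 0 < B ->
    (A * B)^-1 * (u + A * w + v + beta^-1 * (B * s) + c) =
    A^-1 * B^-1 * (u + v + c) + B^-1 * w + A^-1 * (beta^-1 * s).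
  by move=> ? ?; field; rewrite !gt_eqF.
rewrite !split_sum //; apply: lerD; last exact: ler_wpM2r.
apply: lerD; last exact: ler_wpM2r.
by rewrite ler_wpM2r ?addr_ge0 // ler_pM ?invr_ge0 ?(ltW A0') ?(ltW B0').
Qed.

Lemma Phi_decrease k : Phi k.+1 + loss k <= Phi k.
Proof.
have s1 := scale_ge1 k; have [l0 _ _ _] := loss_ge_sum k.
have s0 : 0 <= scale k by apply: le_trans s1.
apply: (@le_trans _ _ (scale k * (wdist k.+3 k.+3 k.+3 + carry k.+1) + scale k * loss k)).
  by apply: lerD; [exact: rescale_le|rewrite ler_peMl].
by rewrite -mulrDr ler_wpM2l // energy_ineq.
Qed.

Lemma Phi_ge k : wdist k.+3 k.+3 k.+2 + carry k <= Phi k.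
Proof. by rewrite /Phi ler_peMl ?scale_ge1 // addr_ge0 ?wdist_ge0 ?carry_ge0. Qed.

Lemma Phi_ge0 k : 0 <= Phi k.
Proof. by apply: le_trans (Phi_ge k); rewrite addr_ge0 ?wdist_ge0 ?carry_ge0. Qed.

Lemma Phi_noninc k : Phi k.+1 <= Phi k.
Proof.
by have [l0 _ _ _] := loss_ge_sum k; have := Phi_decrease k; lra.
Qed.

Lemma Phi_le0 k : Phi k <= Phi 0%N.
Proof. by elim: k => // k; apply: le_trans (Phi_noninc k). Qed.

Lemma Phi_cvg : exists l : R, Phi @ \oo --> l.
Proof.
exists (inf (range Phi)); apply: nonincreasing_cvgn.
  by apply/nonincreasing_seqP => k; exact: Phi_noninc.
by exists 0 => _ [k _ <-]; exact: Phi_ge0.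
Qed.

Lemma loss_cvg0 : loss @ \oo --> 0.
Proof.
have [l Pl] := Phi_cvg.
apply: (squeeze_cvgr (f := fun=> 0) (h := fun k => Phi k - Phi k.+1)).
- apply: nearW => k; have [-> _ _ _] := loss_ge_sum k.
  by rewrite lerBrDr addrC Phi_decrease.
- exact: cvg_cst.
- rewrite -[X in _ --> X](subrr l); apply: cvgB => //.
  by apply: (cvg_subseq (s := succn) _ Pl) => k; exact: leqnSn.
Qed.

Lemma wdist_parts_ge0 k :
  [/\ 0 <= dotv (x k.+2 - hx) (x k.+2 - hx),
  0 <= (1 - a k.+3) * dotv (xag k.+2 - hx) (xag k.+2 - hx),
  0 <= beta^-1 * dotv (y k.+2 - hy) (y k.+2 - hy) &
  0 <= beta^-1 * ((1 - b k.+3) * dotv (yag k.+2 - hy) (yag k.+2 - hy))].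
Proof.
have ib := ltW ibeta_gt0.
split; first exact: dotv_ge0.
- by rewrite mulr_ge0 ?dotv_ge0 ?(ltW (A_gt0 _)).
- by rewrite mulr_ge0 ?dotv_ge0.
- by apply: mulr_ge0 => //; rewrite mulr_ge0 ?dotv_ge0 ?(ltW (B_gt0 _)).
Qed.

Lemma xdist_bound k : dotv (x k.+2 - hx) (x k.+2 - hx) <= Phi 0%N.
Proof.
have [? ? ? ?] := wdist_parts_ge0 k; have := carry_ge0 k.
by have := le_trans (Phi_ge k) (Phi_le0 k); rewrite -wdistE; lra.
Qed.

Lemma ydist_bound k : beta^-1 * dotv (y k.+2 - hy) (y k.+2 - hy) <= Phi 0%N.
Proof.
have [? ? ? ?] := wdist_parts_ge0 k; have := carry_ge0 k.
by have := le_trans (Phi_ge k) (Phi_le0 k); rewrite -wdistE; lra.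
Qed.

Lemma agdist_bound k :
  (1 - a k.+3) * dotv (xag k.+2 - hx) (xag k.+2 - hx)
  + beta^-1 * ((1 - b k.+3) * dotv (yag k.+2 - hy) (yag k.+2 - hy)) <= Phi 0%N.
Proof.
have [? ? ? ?] := wdist_parts_ge0 k; have := carry_ge0 k.
by have := le_trans (Phi_ge k) (Phi_le0 k); rewrite -wdistE; lra.
Qed.

(** * Vanishing increments and residuals *)

Lemma dx_vanish : vanish (fun k => x k.+3 - x k.+2).
Proof.
apply: (vanish_le (cvg0Ml (eps / 4)^-1 loss_cvg0)); apply: nearW => k.
have [_ h _ _] := loss_ge_sum k.
by rewrite ler_pdivlMl ?divr_gt0.
Qed.

Lemma dy_vanish : vanish (fun k => y k.+3 - y k.+2).
Proof.
apply: (vanish_le (cvg0Ml (beta^-1 * eps)^-1 loss_cvg0)); apply: nearW => k.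
have [_ _ _ [h _ _]] := loss_ge_sum k.
by rewrite ler_pdivlMl ?mulr_gt0 ?ibeta_gt0 // -mulrA.
Qed.

(** Since [a k] may tend to 0, the lag [xag - x] itself need not vanish; the residual only contains
    it with the weight [c k], and [c k ^+ 2 <= c k] makes the loss control that product. *)
Lemma xresid_vanish : vanish (fun k => x k.+3 - xmd k.+3).
Proof.
pose c k := a k.+3 * (1 - a k.+3).
have c01 k : 0 <= c k <= 1.
  have := a_gt0 k.+2; have := a_lt1 k.+2; rewrite /c => h1 h2.
  by rewrite mulr_ge0 ?mulr_ile1 //; lra.
have h : vanish (fun k => c k *: (xag k.+2 - x k.+3)).
  apply: (vanish_le loss_cvg0); apply: nearW => k; have [_ _ h _] := loss_ge_sum k.
  apply: le_trans h; rewrite dotvZl dotvZr mulrA ler_wpM2r ?dotv_ge0 //.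
  by have /andP[? ?] := c01 k; rewrite ler_piMl.
have -> : (fun k => x k.+3 - xmd k.+3) =
    (fun k => (1 - c k) *: (x k.+3 - x k.+2) + - (c k *: (xag k.+2 - x k.+3))).
  by apply: funext => k; rewrite xresidE; apply/rowP => i; rewrite !mxE /c; ring.
apply: vanishD; last exact: vanishN.
apply: (@vanishZ _ _ _ _ 1) dx_vanish; apply: nearW => k.
by have /andP[? ?] := c01 k; rewrite ger0_norm; lra.
Qed.

Lemma yresid_vanish : vanish (fun k => y k.+3 - ymd k.+3).
Proof.
pose c k := b k.+3 * (1 - b k.+3).
have -> : (fun k => y k.+3 - ymd k.+3) =
    (fun k => (y k.+3 - y k.+2) + - (c k *: (yag k.+2 - y k.+2))).
  by apply: funext => k; rewrite yresidE.
apply: (vanishD dy_vanish); apply: vanishN.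
apply: (vanish_le (cvg0Ml beta loss_cvg0)); apply: nearW => k.
have [_ _ _ [_ h _]] := loss_ge_sum k.
have := ler_wpM2l (ltW hbeta) h; rewrite mulrA divff ?gt_eqF // mul1r.
apply: le_trans; rewrite dotvZl dotvZr mulrA ler_wpM2r ?dotv_ge0 // -/(c k).
have := b_gt0 k.+2; have := b_lt1 k.+2 => h1 h2.
by rewrite ler_piMl /c ?mulr_ge0 ?mulr_ile1 //; lra.
Qed.

Lemma gap_backtracks_cvg0 (s : nat -> nat) :
  (forall k, (k <= s k)%N /\ backtracks (s k).+1) ->
  (fun k => tau (s k).+1 * (1 + th (s k).+1) * pgap (x (s k).+1)) @ \oo --> 0.
Proof.
move=> sP; have m1 : 0 < 2 * (1 - mu ^+ 2).
  by rewrite mulr_gt0 // subr_gt0 exprn_ilt1 ?mu_lt1 ?(ltW mu_gt0).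
apply: (squeeze_cvgr (f := fun=> 0) (h := fun k => (2 * (1 - mu ^+ 2))^-1 * loss (s k))).
- apply: nearW => k; have [ks bt] := sP k.
  have [_ _ _ [_ _ h]] := loss_ge_sum (s k).
  rewrite mulr_ge0 ?pgap_ge0 ?mulr_ge0 ?(ltW (tau_gt0 _)) ?addr_ge0 ?(ltW (th_gt0 _)) //=.
  rewrite ler_pdivlMl //; apply: le_trans h; rewrite mulrA ler_wpM2r ?pgap_ge0 //.
  rewrite -mulrA ler_pM2l // mulrBl mul1r lerD2l lerN2.
  exact: tauth_backtracks.
- exact: cvg_cst.
- by apply: cvg0Ml; apply: cvg_subseq loss_cvg0 => k; exact: (sP k).1.
Qed.

(** The new lag [xag k.+3 - x k.+2] is [1 - a k.+3] times [xag k.+2 - x k.+2], which supplies the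
    weight [a (1 - a)] of the loss term in [xag k.+2 - x k.+3], up to an increment of [x]. *)
Lemma carry_ag_cvg0 :
  (fun k => a k.+2 * dotv (xag k.+2 - x k.+1) (xag k.+2 - x k.+1)) @ \oo --> 0.
Proof.
rewrite -(cvg_shiftS (fun k => a k.+2 * dotv (xag k.+2 - x k.+1) (xag k.+2 - x k.+1))) /=.
apply: (squeeze_cvgr (f := fun=> 0)
  (h := fun k => 2 * loss k + 2 * dotv (x k.+3 - x k.+2) (x k.+3 - x k.+2))).
- apply: nearW => k; rewrite mulr_ge0 ?dotv_ge0 ?(ltW (a_gt0 _)) //=.
  have [_ _ h _] := loss_ge_sum k.
  have := dotvD_le (xag k.+2 - x k.+3) (x k.+3 - x k.+2).
  rewrite addrA subrK => h2.
  have -> : xag k.+3 - x k.+2 = (1 - a k.+3) *: (xag k.+2 - x k.+2).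
    by rewrite (xag_step k.+2); apply/rowP => i; rewrite !mxE; ring.
  rewrite dotvZl dotvZr.
  have := a_gt0 k.+2; have := a_lt1 k.+2; move: (dotv_ge0 (x k.+3 - x k.+2))
    (dotv_ge0 (xag k.+2 - x k.+2)) (dotv_ge0 (xag k.+2 - x k.+3)) h h2.
  set D := dotv (xag _ - _) _; set X := dotv _ _; set Y := dotv _ _; set A := a _.
  move=> X0 D0 Y0 h h2 A1 A0.
  have A2 : 0 <= A * (1 - A) by rewrite mulr_ge0; lra.
  have : A * (1 - A) <= 1 by rewrite mulr_ile1; lra.
  move=> A3; have : A * (1 - A) * X <= X by rewrite ler_piMl.
  have : A * (1 - A) * D <= A * (1 - A) * (2 * Y + 2 * X) by rewrite ler_wpM2l.
  have : A * (1 - A) * ((1 - A) * D) <= A * (1 - A) * D by rewrite ler_wpM2l // ler_piMl //; lra.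
  by lra.
- exact: cvg_cst.
- by apply: cvg0D; apply: cvg0Ml; [exact: loss_cvg0|exact: dx_vanish].
Qed.

End Energy.

(** * Cluster points of the iterates *)

Lemma iterates_regular :
  [/\ vanish (fun k => x k.+3 - x k.+2), vanish (fun k => y k.+3 - y k.+2),
      vanish (fun k => x k.+3 - xmd k.+3) & vanish (fun k => y k.+3 - ymd k.+3)].
Proof.
have [hx [hy sad]] := hsaddle; have [eps [e0 e1 ea eb]] := margin.
split; [exact: (dx_vanish e0 e1 ea eb sad)|exact: (dy_vanish e0 e1 ea eb sad)|
  exact: (xresid_vanish e0 e1 ea eb sad)|exact: (yresid_vanish e0 e1 ea eb sad)].
Qed.

Lemma iterates_bounded : exists B, forall k,
  dotv (x k.+2) (x k.+2) <= B /\ dotv (y k.+2) (y k.+2) <= B.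
Proof.
have [hx [hy sad]] := hsaddle; have [eps [e0 e1 ea eb]] := margin.
have P0 := Phi_ge0 sad 0; set P := Phi hx hy 0 in P0.
exists (2 * P + 2 * dotv hx hx + (2 * (beta * P) + 2 * dotv hy hy)) => k.
have xb := xdist_bound e0 e1 ea eb sad k; have := ydist_bound e0 e1 ea eb sad k.
rewrite -/P in xb *; rewrite ler_pdivrMl // => yb.
have := dotvD_le (x k.+2 - hx) hx; have := dotvD_le (y k.+2 - hy) hy; rewrite !subrK.
have := dotv_ge0 hx; have := dotv_ge0 hy.
have : 0 <= beta * P by rewrite mulr_ge0 ?(ltW hbeta).
by move=> *; split; lra.
Qed.

(* If the linesearch backtracks, the preceding trial exists because f^* has a prox
   point, and its failure bounds its step below through the norm of K^T. *)
Lemma tau_lower : exists2 t0, 0 < t0 & forall k, t0 <= tau k.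
Proof.
have [C C0 hC] := mulmx_bound (K^T).
(* A trial step [t] with [t ^+ 2 <= c] passes the test for every [yc]. *)
pose c := delta ^+ 2 / (beta * C).
have c0 : 0 < c by rewrite divr_gt0 ?exprn_gt0 ?delta_gt0 ?mulr_gt0.
exists (Num.min (tau 0%N) (mu * Num.sqrt c)).
  by rewrite lt_min htau0 mulr_gt0 ?mu_gt0 ?sqrtr_gt0.
elim=> [|k IH]; first by rewrite ge_min lexx.
have [_ [_ [_ [_ [_ [i [tE [_ [_ [_ [_ fail]]]]]]]]]]] := hiter k.
have t0 := tau_gt0 k; have th0 := th_gt0 k.
case: i => [|i] in tE fail *.
  apply: le_trans IH _; rewrite tE expr0 mulr1 ler_peMr ?(ltW t0) //.
  by rewrite -[leLHS](sqrtr1) ler_sqrt; lra.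
pose t := tau k * Num.sqrt (1 + th k) * mu ^+ i.
have tt0 : 0 < t by rewrite !mulr_gt0 ?exprn_gt0 ?mu_gt0 // sqrtr_gt0 addr_gt0.
have [hx [hy [_ ffin _]]] := hsaddle.
have [cc [d hmin]] := conjugate_minorant fP.
have [yc pr] := prox_exists (ymd k.+2 + (beta * t) *:
  ((x k.+1 + (t / tau k) *: (x k.+1 - x k)) *m K)) (conjugate_lsc fP)
  (mulr_gt0 hbeta tt0) ffin hmin.
have tE' : tau k.+1 = mu * t by rewrite tE exprSr mulrA mulrC.
have /= := fail i yc (ltnSn i) pr; rewrite -/t; clearbody t => {fail tE pr}.
move=> /negP; rewrite -ltNge -mulmxBl.
rewrite -(ltr_pXn2r (n := 2)) ?nnegrE ?mulr_ge0 ?enorm_ge0 ?sqrtr_ge0 ?(ltW delta_gt0) ?(ltW tt0) //.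
rewrite !exprMn !enormK sqr_sqrtr ?(ltW hbeta) //.
set D := dotv (yc - _) _ => lt.
have D0 : 0 <= D := dotv_ge0 _.
have bt : 0 <= beta * t ^+ 2 by rewrite mulr_ge0 ?(ltW hbeta) ?sqr_ge0.
have := lt_le_trans lt (ler_wpM2l bt (hC _)); rewrite -/D mulrA => lt2.
(* A trial with [yc = y k.+1] would pass the test, so a rejected one has moved. *)
have D1 : 0 < D.
  by rewrite lt_neqAle D0 andbT eq_sym; apply: contraTneq lt2 => ->; rewrite !mulr0 ltxx.
move: lt2; rewrite ltr_pM2r // => lt3.
have ct : c < t ^+ 2.
  by rewrite /c ltr_pdivrMr ?mulr_gt0 // mulrA [t ^+ 2 * _]mulrC.
rewrite ge_min; apply/orP; right; rewrite tE' ler_pM2l ?mu_gt0 //.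
by rewrite -[leRHS](ger0_norm (ltW tt0)) -sqrtr_sqr ler_sqrt ?sqr_ge0 // ltW.
Qed.

(** Pass to the limit in both proximal inequalities divided by [tau]: residuals stay negligible
    because [tau] is bounded below, and semicontinuity handles the function values. *)
Lemma cluster_saddle (s : nat -> nat) px py :
  (forall k, (k <= s k)%N) -> vanish (fun k => x (s k).+2 - px) ->
  vanish (fun k => y (s k).+2 - py) -> saddle_point g f K px py.
Proof.
move=> sk xp yp.
have [dx dy rx ry] := iterates_regular.
have [t0 t00 tlow] := tau_lower.
have sub d (u : nat -> 'rV[R]_d) : vanish u -> vanish (fun k => u (s k)) := cvg_subseq sk.
have sub1 d (u : nat -> 'rV[R]_d) : vanish u -> vanish (fun k => u (s k).+1).
  by move=> u0; apply: (@cvg_subseq _ _ _ (fun k => (s k).+1) _ u0) => k; exact: leqW.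
have x3 : vanish (fun k => x (s k).+3 - px).
  by have := vanishD (sub _ _ dx) xp; under eq_fun do rewrite subrKA.
have y3 : vanish (fun k => y (s k).+3 - py).
  by have := vanishD (sub _ _ dy) yp; under eq_fun do rewrite subrKA.
have y4 : vanish (fun k => y (s k).+4 - py).
  by have := vanishD (sub1 _ _ dy) y3; under eq_fun do rewrite subrKA.
have ivt k : `|(tau k)^-1| <= t0^-1.
  by rewrite ger0_norm ?invr_ge0 ?(ltW (tau_gt0 _)) // lef_pV2 ?posrE ?tau_gt0.
have xb : vanish (fun k => xbar (s k).+3 - px).
  have : vanish (fun k => th (s k).+3 *: (x (s k).+3 - x (s k).+2)).
    apply: (@vanishZ _ _ _ _ theta) (sub _ _ dx); apply: nearW => k.
    by rewrite ger0_norm ?hthle // ltW ?th_gt0.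
  move=> h; have := vanishD x3 h; congr vanish; apply: funext => k.
  by rewrite xbarE addrAC.
have primal z : g z \is a fin_num ->
    (g px <= (fine (g z) + dotv (py *m K^T) (z - px))%:E)%E.
  move=> gz.
  apply: (@lsc_limit _ _ _ (fun k => x (s k).+3) _
    (fun k => fine (g z) + (dotv ((tau (s k).+2)^-1 *: (x (s k).+3 - xmd (s k).+3)) (z - x (s k).+3)
       + dotv (y (s k).+3 *m K^T) (z - x (s k).+3)))) => //.
  - by case: hg.
  - have zx : vanish (fun k => z - x (s k).+3 - (z - px)).
      by have := vanishN x3; congr vanish; apply: funext => k; apply/rowP => i; rewrite !mxE; ring.
    apply: cvgD; first exact: cvg_cst.
    rewrite -[X in _ --> X]add0r; apply: cvgD.
      rewrite -(dotv0l (z - px)).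
      apply: cvg_dotv zx; under eq_fun do rewrite subr0.
      by apply: (@vanishZ _ _ _ _ t0^-1) (sub _ _ rx); apply: nearW => k.
    apply: cvg_dotv zx.
    by have := vanish_mulmx K^T y3; under eq_fun do rewrite mulmxBl.
  - move=> k; rewrite -(fineK (g_fin (s k).+2)) lee_fin.
    have := xprox_ineq (s k).+2 gz; rewrite dotvDl dotvZl.
    rewrite -[tau _ * (_ - _) <= _]ler_pdivlMl ?tau_gt0 // mulrDr mulKf ?gt_eqF ?tau_gt0 //.
    by rewrite dotvZl; lra.
have dual z : conjugate f z \is a fin_num ->
    (conjugate f py <= (fine (conjugate f z) - dotv (px *m K) (z - py))%:E)%E.
  move=> fz.
  apply: (@lsc_limit _ _ _ (fun k => y (s k).+4) _
    (fun k => fine (conjugate f z) + (beta^-1 * dotv ((tau (s k).+3)^-1 *: (y (s k).+4 - ymd (s k).+4)) (z - y (s k).+4)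
       - dotv (xbar (s k).+3 *m K) (z - y (s k).+4)))) => //.
  - exact: conjugate_lsc.
  - have zy : vanish (fun k => z - y (s k).+4 - (z - py)).
      by have := vanishN y4; congr vanish; apply: funext => k; apply/rowP => i; rewrite !mxE; ring.
    apply: cvgD; first exact: cvg_cst.
    rewrite -[X in _ --> X]add0r; apply: cvgD.
      apply: cvg0Ml.
      rewrite -(dotv0l (z - py)).
      apply: cvg_dotv zy; under eq_fun do rewrite subr0.
      by apply: (@vanishZ _ _ _ _ t0^-1) (sub1 _ _ ry); apply: nearW => k.
    apply: cvgN; apply: cvg_dotv zy.
    by have := vanish_mulmx K xb; under eq_fun do rewrite mulmxBl.
  - move=> k; rewrite -(fineK (f_fin (s k).+2)) lee_fin.
    have := yprox_ineq (s k).+2 fz.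
    rewrite -ler_pdivlMl ?tau_gt0 // mulrBr mulKf ?gt_eqF ?tau_gt0 //.
    by rewrite dotvZl; lra.
have [hx [hy [gh fh _]]] := hsaddle.
have gp : g px \is a fin_num.
  have [[gN _] _ _] := hg; have := primal _ gh; have := gN px.
  by case: (g px) => //; rewrite leye_eq.
have fp : conjugate f py \is a fin_num.
  have := dual _ fh; have := conjugate_neqNy py fP.
  by case: (conjugate f py) => //; rewrite leye_eq.
have [gP _ _] := hg.
apply: saddle_pointI => // z zf.
  by have := primal z zf; rewrite -{1}(fineK gp) lee_fin.
by have := dual z zf; rewrite -{1}(fineK fp) lee_fin.
Qed.

(** Concatenating [x] and [y] into one row vector yields a common subsequence. *)
Lemma joint_subsequence (Q : nat -> Prop) :
  (forall N, exists2 k, (N <= k)%N & Q k) ->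
  exists px py (s : nat -> nat), [/\ forall k, (k <= s k)%N /\ Q (s k),
    saddle_point g f K px py,
    vanish (fun k => x (s k).+2 - px) & vanish (fun k => y (s k).+2 - py)].
Proof.
move=> Qinf; have [B hB] := iterates_bounded.
have zB k : Q k -> dotv (row_mx (x k.+2) (y k.+2)) (row_mx (x k.+2) (y k.+2)) <= B + B.
  by move=> _; have [? ?] := hB k; rewrite dotv_row_mx lerD.
have [p [s [sP sp]]] := bounded_subsequence (z := fun k => row_mx (x k.+2) (y k.+2)) zB Qinf.
have spE k : dotv (row_mx (x (s k).+2) (y (s k).+2) - p) (row_mx (x (s k).+2) (y (s k).+2) - p) =
    dotv (x (s k).+2 - lsubmx p) (x (s k).+2 - lsubmx p)
    + dotv (y (s k).+2 - rsubmx p) (y (s k).+2 - rsubmx p).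
  by rewrite -{1 2}(hsubmxK p) opp_row_mx add_row_mx dotv_row_mx.
have xp : vanish (fun k => x (s k).+2 - lsubmx p).
  by apply: (vanish_le sp); apply: nearW => k; rewrite spE lerDl dotv_ge0.
have yp : vanish (fun k => y (s k).+2 - rsubmx p).
  by apply: (vanish_le sp); apply: nearW => k; rewrite spE lerDr dotv_ge0.
exists (lsubmx p), (rsubmx p), s; split=> //.
by apply: cluster_saddle xp yp => k; exact: (sP k).1.
Qed.

(** Without backtracking [th k.+1 ^+ 2 = 1 + th k], so one step gives [th >= 1] and a second gives
    [th ^+ 2 >= 2]. *)
Lemma tau_sq_growth N : (forall k, (N <= k)%N -> ~ backtracks k) ->
  forall k, (N.+1 <= k)%N -> 2 * tau k ^+ 2 <= tau k.+1 ^+ 2.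
Proof.
move=> nb [//|k]; rewrite ltnS => Nk.
have := sqr_th_nobacktrack (nb _ Nk); have := sqr_th_nobacktrack (nb _ (leqW Nk)).
have := th_gt0 k; have := th_gt0 k.+1 => h1 h0 e2 e1.
rewrite (tauE k.+1) exprMn ler_wpM2r ?sqr_ge0 // e2.
have : 1 <= th k.+1 by rewrite -(@ler_pXn2r _ 2) ?nnegrE ?(ltW h1) // expr1n e1; lra.
by lra.
Qed.

(* The linesearch test makes the steps of y_k K^T of size O(1/tau_k); without
   backtracking tau_k^2 at least doubles, so these steps sum up to O(1/tau_k). *)
Lemma dual_image_cauchy N : (forall k, (N <= k)%N -> ~ backtracks k) ->
  exists M : R, forall k j, (N.+1 < k)%N ->
    tau k ^+ 2 * dotv ((y (k + j) - y k) *m K^T) ((y (k + j) - y k) *m K^T) <= M.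
Proof.
move=> nb; have [B hB] := iterates_bounded.
have B0 : 0 <= B by apply: le_trans (hB 0%N).1; exact: dotv_ge0.
pose C := delta ^+ 2 * (4 * B) / beta.
have C0 : 0 <= C.
  by apply: divr_ge0 (ltW hbeta); apply: mulr_ge0; [exact: sqr_ge0|rewrite mulr_ge0].
have step k : tau k.+2 ^+ 2 *
    dotv ((y k.+3 - y k.+2) *m K^T) ((y k.+3 - y k.+2) *m K^T) <= C.
  rewrite /C ler_pdivlMr // [leLHS]mulrC mulrA.
  apply: le_trans (linesearch_sq k.+1) _; rewrite ler_wpM2l ?sqr_ge0 //.
  have := dotvD_le (y k.+3) (- y k.+2); rewrite dotvNl dotvNr opprK.
  by have [_ h1] := hB k; have [_ h2] := hB k.+1; lra.
(* 12 is fixed by the recursion: doubling of [tau ^+ 2] halves the bound to [6 * C], and the weights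
   [3 / 2] and [3] give [9 * C + 3 * C]. *)
exists (12 * C) => k j; elim: j k => [|j IH] k Nk.
  by rewrite addn0 subrr mul0mx dotv0l mulr0 mulr_ge0.
case: k Nk => [//|[//|k]] Nk.
have := IH k.+3 (leqW Nk); rewrite addSnnS.
set u := y _ - y k.+3 => h.
have -> : y (k.+2 + j.+1)%N - y k.+2 = u + (y k.+3 - y k.+2) by rewrite subrKA.
rewrite mulmxDl; move: h (step k); set U := u *m _; set V := _ *m K^T => hU hV.
have t2 : 2 * tau k.+2 ^+ 2 <= tau k.+3 ^+ 2 by exact: tau_sq_growth nb _ (ltnW Nk).
have hT : tau k.+2 ^+ 2 * dotv U U <= 6 * C.
  have : 2 * tau k.+2 ^+ 2 * dotv U U <= tau k.+3 ^+ 2 * dotv U U by rewrite ler_wpM2r ?dotv_ge0.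
  by lra.
have hS : dotv (U + V) (U + V) <= 3 / 2 * dotv U U + 3 * dotv V V.
  have := dotv_young (1 / 2) U V.
  by rewrite !dotv_lin (dotvC V U); lra.
have : tau k.+2 ^+ 2 * dotv (U + V) (U + V) <= tau k.+2 ^+ 2 * (3 / 2 * dotv U U + 3 * dotv V V).
  by rewrite ler_wpM2l ?sqr_ge0.
by lra.
Qed.

(* Each backtracking step dissipates a fixed fraction of the term
   tau (1 + theta) pgap; if backtracking stops, the step lengths grow geometrically. *)
Lemma good_subsequence : exists px py (s : nat -> nat),
  [/\ forall k, (k <= s k)%N, saddle_point g f K px py,
    vanish (fun k => x (s k).+2 - px), vanish (fun k => y (s k).+2 - py) &
    (fun k => tau (s k).+1 * (1 + th (s k).+1) * pgap px py (x (s k).+1)) @ \oo --> 0].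
Proof.
have [often|rare] := pselect (forall N, exists2 k, (N <= k)%N & backtracks k.+1).
  have [px [py [s [sP sad xp yp]]]] := joint_subsequence often.
  have [eps [e0 e1 ea eb]] := margin.
  exists px, py, s; split=> // [k|]; first exact: (sP k).1.
  exact: (gap_backtracks_cvg0 e0 e1 ea eb sad sP).
have [N nb] : exists N, forall k, (N <= k)%N -> ~ backtracks k.
  have /existsNP [N hN] := rare; exists N.+1 => -[//|k] Nk bt.
  by apply: hN; exists k.
have [px [py [s [sP sad xp yp]]]] :=
  @joint_subsequence (fun=> True) (fun N => ex_intro2 _ _ N (leqnn N) Logic.I).
have sk k : (k <= s k)%N by have [] := sP k.
have [dx dy rx ry] := iterates_regular.
have sub d (u : nat -> 'rV[R]_d) : vanish u -> vanish (fun k => u (s k)) := cvg_subseq sk.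
have sub1 d (u : nat -> 'rV[R]_d) : vanish u -> vanish (fun k => u (s k).+1).
  by move=> u0; apply: (@cvg_subseq _ _ _ (fun k => (s k).+1) _ u0) => k; exact: leqW.
have x3 : vanish (fun k => x (s k).+3 - px).
  by have := vanishD (sub _ _ dx) xp; under eq_fun do rewrite subrKA.
have x4 : vanish (fun k => x (s k).+4 - px).
  by have := vanishD (sub1 _ _ dx) x3; under eq_fun do rewrite subrKA.
have y3 : vanish (fun k => y (s k).+3 - py).
  by have := vanishD (sub _ _ dy) yp; under eq_fun do rewrite subrKA.
have y4 : vanish (fun k => y (s k).+4 - py).
  by have := vanishD (sub1 _ _ dy) y3; under eq_fun do rewrite subrKA.
have [M hM] := dual_image_cauchy nb.
(* Letting the second index run along [s] replaces it by the cluster point [py]. *)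
have lim_bound k : (N.+1 < k)%N ->
    tau k ^+ 2 * dotv ((y k - py) *m K^T) ((y k - py) *m K^T) <= M.
  move=> Nk.
  have v : vanish (fun j => (y (s j).+2 - y k) *m K^T - (py - y k) *m K^T).
    have := vanish_mulmx K^T yp; congr vanish; apply: funext => j.
    by rewrite -mulmxBl opprB addrA subrK.
  have c : (fun j => tau k ^+ 2 * dotv ((y (s j).+2 - y k) *m K^T) ((y (s j).+2 - y k) *m K^T)) @ \oo
      --> tau k ^+ 2 * dotv ((py - y k) *m K^T) ((py - y k) *m K^T).
    by apply: cvgMl_tmp; exact: cvg_dotv.
  have -> : dotv ((y k - py) *m K^T) ((y k - py) *m K^T) =
      dotv ((py - y k) *m K^T) ((py - y k) *m K^T).
    by rewrite -[y k - py]opprB mulNmx dotvNl dotvNr opprK.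
  apply: (cvgr_to_le c); exists k => // j /= kj.
  have kj' : (k <= (s j).+2)%N by apply: leq_trans kj (leqW (leqW (sk j))).
  by rewrite -(subnKC kj'); exact: hM.
exists px, py, (fun k => (s k).+2); split=> // [k|]; first exact: leqW (leqW (sk k)).
have th0 : 0 <= theta by apply: le_trans (hthle 0%N); rewrite hth0.
(* The proximal inequality of [x (s k).+3] at [px] bounds [tau] times its gap by a product with
   [W k], which stays bounded by [lim_bound] although [tau] grows; its other factor
   [px - x (s k).+3] vanishes. *)
pose W k := x (s k).+3 - xmd (s k).+3 + tau (s k).+2 *: ((y (s k).+3 - py) *m K^T).
apply: (squeeze_cvgr (f := fun=> 0)
  (h := fun k => theta * (1 + theta) * dotv (px - x (s k).+3) (W k))).
- apply: nearW => k.
  have g0 := saddle_gap_primal sad (g_fin (s k).+2); rewrite -/(pgap px py _) in g0.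
  have t0 := tau_gt0 (s k).+2; have h0 := th_gt0 (s k).+3; have hle := hthle (s k).+3.
  have T0 : 0 <= tau (s k).+3 * (1 + th (s k).+3).
    by rewrite mulr_ge0 ?addr_ge0 ?(ltW h0) ?(ltW (tau_gt0 _)).
  rewrite (mulr_ge0 T0 g0) /=.
  have [gp _ _] := sad.
  have key : tau (s k).+2 * pgap px py (x (s k).+3) <= dotv (px - x (s k).+3) (W k).
    have := xprox_ineq (s k).+2 gp; rewrite /pgap /W.
    rewrite !(dotvDl _ (tau _ *: _)) dotvZl (dotvC (px - _)) (dotvDl _ (tau _ *: _)) dotvZl.
    rewrite mulmxBl (dotvDl (y _ *m _)) dotvNl -[x _ - px]opprB dotvNr.
    by lra.
  rewrite (tauE (s k).+2).
  have q0 : 0 <= tau (s k).+2 * pgap px py (x (s k).+3) by rewrite mulr_ge0 ?(ltW t0).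
  have -> : th (s k).+3 * tau (s k).+2 * (1 + th (s k).+3) * pgap px py (x (s k).+3) =
    th (s k).+3 * (1 + th (s k).+3) * (tau (s k).+2 * pgap px py (x (s k).+3)) by ring.
  apply: ler_pM key => //; first by rewrite mulr_ge0 ?addr_ge0 ?(ltW h0).
  by rewrite ler_pM ?addr_ge0 ?(ltW h0) ?lerD2l.
- exact: cvg_cst.
- apply: cvg0Ml; apply: (@cvg_dotv0 _ _ _ _ (2 * 1 + 2 * M)).
    by have := vanishN x3; under eq_fun do rewrite opprB.
  have r1 := vanish_lt (sub _ _ rx) ltr01.
  apply: filterS2 r1 (_ : \forall k \near \oo, (N.+1 <= k)%N) => [k r1 Nk|]; last by exists N.+1.
  apply: le_trans (dotvD_le _ _) _; rewrite lerD // ler_pM2l //; first exact: ltW.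
  rewrite dotvZl dotvZr mulrA -expr2.
  have sNk : (N.+1 < (s k).+2)%N by rewrite ltnS leqW // (leq_trans Nk).
  apply: le_trans (lim_bound _ (leqW sNk)); rewrite ler_wpM2r ?dotv_ge0 //.
  apply: le_trans (tau_sq_growth nb (ltnW sNk)).
  by rewrite ler_peMl ?sqr_ge0 // ler1n.
Qed.

(** Undoing the convergent factor [scale] turns [Phi] into [Psi], which has a limit [L]. In
    [lagged_energy_cvg0] the averages are weighted by the limits of [1 - a] and [1 - b], so that the
    weights no longer change with [k]. *)
Lemma iterates_cvg : exists hx hy, saddle_point g f K hx hy /\
  x @ \oo --> hx /\ y @ \oo --> hy.
Proof.
have [px [py [s [sk sad xp yp gapp]]]] := good_subsequence.
have [eps [e0 e1 ea eb]] := margin.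
have [l Pl] := Phi_cvg e0 e1 ea eb sad.
have [ainf [acvg ainf0 aml]] := noninc_cvg (fun k => a_noninc k.+2) (fun k => ltW (a_gt0 k.+2)).
have [binf [bcvg binf0 bml]] := noninc_cvg (fun k => b_noninc k.+2) (fun k => ltW (b_gt0 k.+2)).
pose u k := dotv (x k.+2 - px) (x k.+2 - px).
pose v k := beta^-1 * dotv (y k.+2 - py) (y k.+2 - py).
pose w k := dotv (xag k.+2 - px) (xag k.+2 - px).
pose z k := beta^-1 * dotv (yag k.+2 - py) (yag k.+2 - py).
have ib : 0 <= beta^-1 by rewrite invr_ge0 ltW.
have u0 k : 0 <= u k by exact: dotv_ge0.
have w0 k : 0 <= w k by exact: dotv_ge0.
have v0 k : 0 <= v k by rewrite mulr_ge0 ?dotv_ge0.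
have z0 k : 0 <= z k by rewrite mulr_ge0 ?dotv_ge0.
pose Psi k := u k + (1 - a k.+3) * w k + v k + (1 - b k.+3) * z k + carry px py k.
have PsiE k : Psi k = Phi px py k * ((1 - a k.+3) * (1 - b k.+3)).
  have A1 : 1 - a k.+3 != 0 by rewrite gt_eqF // subr_gt0 a_lt1.
  have B1 : 1 - b k.+3 != 0 by rewrite gt_eqF // subr_gt0 b_lt1.
  rewrite /Phi /scale -wdistE /Psi /u /v /w /z.
  by field; rewrite A1 B1 gt_eqF.
have ac0 : (fun k => a k.+3 - ainf) @ \oo --> 0.
  by rewrite -[X in _ --> X](subrr ainf); apply: cvgB => //; exact: cvg_cst.
have bc0 : (fun k => b k.+3 - binf) @ \oo --> 0.
  by rewrite -[X in _ --> X](subrr binf); apply: cvgB => //; exact: cvg_cst.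
pose L := l * ((1 - ainf) * (1 - binf)).
have Psicvg : Psi @ \oo --> L.
  rewrite (funext PsiE); apply: cvgM => //.
  by apply: cvgM; apply: cvgB => //; exact: cvg_cst.
pose P := Phi px py 0.
have a1 : 0 < 1 - a 1%N by rewrite subr_gt0 a_lt1.
have b1 : 0 < 1 - b 1%N by rewrite subr_gt0 b_lt1.
have wzb k : w k <= P / (1 - a 1%N) /\ z k <= P / (1 - b 1%N).
  have := agdist_bound e0 e1 ea eb sad k; rewrite -/P -/(w k).
  have -> : beta^-1 * ((1 - b k.+3) * dotv (yag k.+2 - py) (yag k.+2 - py)) = (1 - b k.+3) * z k.
    by rewrite /z; ring.
  have hA : (1 - a 1%N) * w k <= (1 - a k.+3) * w k.
    by rewrite ler_wpM2r // lerD2l lerN2 a_le1.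
  have hB : (1 - b 1%N) * z k <= (1 - b k.+3) * z k.
    by rewrite ler_wpM2r // lerD2l lerN2 b_le1.
  have p1 : 0 <= (1 - a 1%N) * w k by rewrite mulr_ge0 // ltW.
  have p2 : 0 <= (1 - b 1%N) * z k by rewrite mulr_ge0 // ltW.
  by move=> h; split; rewrite ler_pdivlMr // mulrC; lra.
(* The distance of [Psi] to its limit, plus the cost of replacing the current weights of the
   averages by their limits. *)
pose nu k := `|Psi k - L| + ((a k.+3 - ainf) * (P / (1 - a 1%N)) + (b k.+3 - binf) * (P / (1 - b 1%N))).
have P0 : 0 <= P by exact: Phi_ge0 sad 0.
have alpha0 : 0 <= 1 - ainf by rewrite subr_ge0 (le_trans (aml 0%N)) // ltW ?a_lt1.
have beta0 : 0 <= 1 - binf by rewrite subr_ge0 (le_trans (bml 0%N)) // ltW ?b_lt1.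
have uv0 : (fun k => u k + v k) @ \oo --> 0.
  apply: (@lagged_energy_cvg0 R (fun k => (1 - ainf) * w k) (fun k => (1 - binf) * z k) u v nu
    (fun k => a k.+3) (fun k => b k.+3) L (Num.max (a 1%N) (b 1%N))).
  - by rewrite gt_max a_lt1 b_lt1.
  - by move=> k; rewrite (ltW (a_gt0 _)) le_max a_le1.
  - by move=> k; rewrite (ltW (b_gt0 _)) le_max b_le1 orbT.
  - by move=> k; split=> //; rewrite mulr_ge0.
  - move=> k; have cw : w k.+1 <= (1 - a k.+3) * w k + a k.+3 * u k.
      rewrite /w /u (xag_step k.+2).
      have -> : (1 - a k.+3) *: xag k.+2 + a k.+3 *: x k.+2 - px =
          (1 - a k.+3) *: (xag k.+2 - px) + a k.+3 *: (x k.+2 - px).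
        by apply/rowP => i; rewrite !mxE; ring.
      by apply: dotv_convex; rewrite !ltW ?a_gt0 ?a_lt1.
    have := ler_wpM2l alpha0 cw.
    have : 0 <= ainf * (a k.+3 * u k) by apply: mulr_ge0 => //; rewrite mulr_ge0 ?(ltW (a_gt0 _)).
    by lra.
  - move=> k; have cz : z k.+1 <= (1 - b k.+3) * z k + b k.+3 * v k.
      rewrite /z /v (yag_step k.+1).
      have -> : (1 - b k.+3) *: yag k.+2 + b k.+3 *: y k.+2 - py =
          (1 - b k.+3) *: (yag k.+2 - py) + b k.+3 *: (y k.+2 - py).
        by apply/rowP => i; rewrite !mxE; ring.
      rewrite ![_ * (beta^-1 * _)]mulrCA -mulrDr ler_wpM2l //.
      by apply: dotv_convex; rewrite !ltW ?b_gt0 ?b_lt1.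
    have := ler_wpM2l beta0 cz.
    have : 0 <= binf * (b k.+3 * v k) by apply: mulr_ge0 => //; apply: mulr_ge0 (v0 k); exact: ltW (b_gt0 _).
    by lra.
  - move=> k; have [wb zb] := wzb k; have c0 := carry_ge0 sad k.
    have : (a k.+3 - ainf) * w k <= (a k.+3 - ainf) * (P / (1 - a 1%N)).
      by rewrite ler_wpM2l // subr_ge0 aml.
    have : (b k.+3 - binf) * z k <= (b k.+3 - binf) * (P / (1 - b 1%N)).
      by rewrite ler_wpM2l // subr_ge0 bml.
    have := ler_norm (Psi k - L); rewrite /nu.
    set N := `|_|; rewrite /Psi.
    by lra.
  - move=> k; rewrite /nu addr_ge0 // addr_ge0 // mulr_ge0 ?subr_ge0 //.
      by rewrite divr_ge0 // ltW.
    by rewrite divr_ge0 // ltW.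
  - apply: cvg0D.
      rewrite -(normr0 R); apply: cvg_norm.
      by rewrite -[X in _ --> X](subrr L); apply: cvgB => //; exact: cvg_cst.
    apply: cvg0D.
      by rewrite -(mul0r (P / (1 - a 1%N))); exact: cvgMr_tmp.
    by rewrite -(mul0r (P / (1 - b 1%N))); exact: cvgMr_tmp.
  (* Along [s] the terms [u], [v] and [carry] vanish, so the averages carry all of [Psi]; passing to
     the limit weights can only increase their share. *)
  - move=> e N e_gt0.
    have us : (fun j => u (s j)) @ \oo --> 0 by exact: xp.
    have vs : (fun j => v (s j)) @ \oo --> 0 by apply: cvg0Ml; exact: yp.
    have cs : (fun j => carry px py (s j)) @ \oo --> 0.
      apply: cvg0D; first exact: (cvg_subseq sk (carry_ag_cvg0 e0 e1 ea eb sad)).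
      by under eq_fun do rewrite -mulrA; exact: (cvg0Ml 2 gapp).
    have tot := cvg0D (cvg0D us vs) cs.
    have tot2 : (fun j => Psi (s j) - (u (s j) + v (s j) + carry px py (s j))) @ \oo --> L.
      by rewrite -[X in _ --> X]subr0; apply: cvgB => //; exact: cvg_subseq sk Psicvg.
    have [j0 _ hj] := cvgr_distC_lt _ _ tot2 _ e_gt0.
    exists (s (j0 + N)%N); first by apply: leq_trans (sk _); exact: leq_addl.
    have := hj (j0 + N)%N (leq_addr _ _) => /=; rewrite ltr_norml => /andP[h _].
    set k := s _ in h *.
    have : (1 - a k.+3) * w k <= (1 - ainf) * w k by rewrite ler_wpM2r // lerD2l lerN2 aml.
    have : (1 - b k.+3) * z k <= (1 - binf) * z k by rewrite ler_wpM2r // lerD2l lerN2 bml.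
    by rewrite /Psi in h; lra.
exists px, py; split=> //; split.
  rewrite -(cvg_shiftn 2) /=; under eq_fun do rewrite addn2.
  apply: vanish_cvg; apply: (vanish_le uv0); apply: nearW => k.
  by rewrite -/(u k) lerDl.
rewrite -(cvg_shiftn 2) /=; under eq_fun do rewrite addn2.
apply: vanish_cvg; apply: (vanish_le (cvg0Ml beta uv0)); apply: nearW => k.
by rewrite mulrDr /v mulVKf ?gt_eqF // lerDr mulr_ge0 // ltW.
Qed.

End Run.

Unset Implicit Arguments.
Set Strict Implicit.
Set Printing Implicit Defensive.

Theorem theorem3p5 (R : realType) (n m : nat)
  (g : 'rV[R]_n -> \bar R) (f : 'rV[R]_m -> \bar R) (K : 'M[R]_(n, m))
  (a b : nat -> R) (beta mu theta delta : R)
  (x xag xmd xbar : nat -> 'rV[R]_n) (y yag ymd : nat -> 'rV[R]_m)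
  (tau th : nat -> R) :
  proper_closed_convex g -> proper_closed_convex f ->
  (exists hx hy, saddle_point g f K hx hy) ->
  (forall k, (1 <= k)%N -> 0 < a k < 1 /\ 0 < b k < 1) ->
  (forall k, (1 <= k)%N -> a k.+1 <= a k /\ b k.+1 <= b k) ->
  0 < tau 0 -> 0 < beta -> 0 < mu < 1 -> 0 < theta -> 0 < delta < 1 ->
  (forall k, (1 <= k)%N ->
     delta + theta ^+ 2 * a k + a k < 1 /\ delta + b k < 1) ->
  (* initialisation *)
  xag 0%N = x 0%N -> yag 1%N = y 1%N -> th 0%N = 1 ->
  (* iteration k = 1, 2, ... (written with k.+1 for k) *)
  (forall k : nat,
     (* (1) *)
     xag k.+1 = (1 - a k.+1) *: xag k + a k.+1 *: x k /\
     yag k.+2 = (1 - b k.+2) *: yag k.+1 + b k.+2 *: y k.+1 /\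
     (* (2) *)
     xmd k.+1 = (1 - a k.+1) *: x k + a k.+1 *: xag k.+1 /\
     ymd k.+2 = (1 - b k.+2) *: y k.+1 + b k.+2 *: yag k.+2 /\
     (* (3) *)
     is_prox g (tau k) (xmd k.+1 - tau k *: (y k.+1 *m K^T)) (x k.+1) /\
     (* (4) linesearch: the accepted trial is the first index i for which the
        test succeeds, trial j using step tau_k sqrt(1+theta_k) mu^j *)
     exists i : nat,
       tau k.+1 = tau k * Num.sqrt (1 + th k) * mu ^+ i /\
       th k.+1 = tau k.+1 / tau k /\
       xbar k.+1 = x k.+1 + th k.+1 *: (x k.+1 - x k) /\
       is_prox (conjugate f) (beta * tau k.+1)
         (ymd k.+2 + (beta * tau k.+1) *: (xbar k.+1 *m K)) (y k.+2) /\
       Num.sqrt beta * tau k.+1 * enorm (y k.+2 *m K^T - y k.+1 *m K^T)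
         <= delta * enorm (y k.+2 - y k.+1) /\
       (forall (j : nat) (yc : 'rV[R]_m), (j < i)%N ->
          let t := tau k * Num.sqrt (1 + th k) * mu ^+ j in
          is_prox (conjugate f) (beta * t)
            (ymd k.+2 + (beta * t) *:
               ((x k.+1 + (t / tau k) *: (x k.+1 - x k)) *m K)) yc ->
          ~ (Num.sqrt beta * t * enorm (yc *m K^T - y k.+1 *m K^T)
               <= delta * enorm (yc - y k.+1)))) ->
  (* theta is an upper bound for the theta_k *)
  (forall k, th k <= theta) ->
  exists hx hy, saddle_point g f K hx hy /\
    x @ \oo --> hx /\ y @ \oo --> hy.
Proof.
move=> hg hf hsad hab hmon htau0 hbeta hmu _ hdelta hcond _ _ hth0 hiter hthle.
exact: iterates_cvg hg hf hsad hab hmon htau0 hbeta hmu hdelta hcond hth0 hiter hthle.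
Qed.
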